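(* Let $v$ satisfy Assumption (V) (see context), let $m\in\mathbb N\cup\{\infty\}$ and $p\in[0,p^* )$ with $p^*=|v(z_{\max})|/z_{\max}$. Then: (a) For every $N\ge 2$, the map $\mathcal E_N$ on $\mathbb R_+^{N-1}$ has a unique minimizer $(z_1^{(N)},\ldots,z_{N-1}^{(N)})$. All spacings of the minimizer lie in $[z_{\min},z_{\max}]$. (b) As $j,N\to\infty$ along $N-j\to\infty$, we have $z_j^{(N)}\to a$, where $a\in(z_{\min},z_{\max}]$ is the unique minimizer of $\mathbb R_+\ni r\mapsto pr+\sum_{k=1}^m v(kr)$. (c) The limit $e_0=\lim_{N\to\infty}E_N/N$ exists, satisfies $e_0<0$, and is given by $$e_0=pa+\sum_{k=1}^m v(ka)=\min_{r>0}\Bigl(pr+\sum_{k=1}^m v(kr)\Bigr).$$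
   Context: $\mathbb N=\{1,2,\ldots\}$, $\mathbb R_+=(0,\infty)$. Assumption (V): $v:(0,\infty)\to\mathbb R\cup\{+\infty\}$ equals $+\infty$ on $(0,r_{\rm hc}]$ for some $r_{\rm hc}\ge 0$ and is $C^2$ on $(r_{\rm hc},\infty)$. There exist $r_{\rm hc}<z_{\min}<z_{\max}<2z_{\min}$ and $\alpha_1,\alpha_2>0$, $s>2$ such that: (i) $z_{\max}$ is the unique minimizer of $v$ and $v(z_{\max})<0$; $v$ is decreasing on $(0,z_{\max})$ and increasing and non-positive on $(z_{\max},\infty)$. (ii) $v(z)\ge-\alpha_1z^{-s}$ for all $z>0$, and $v(z)+v(z_{\max})-2\alpha_1\sum_{n=2}^\infty(nz)^{-s}>0$ for all $z<z_{\min}$. (iii) $v''$ is decreasing on $[z_{\min},z_{\max}]$ and increasing and non-positive on $[2z_{\min},\infty)$. (iv) $v''(z)\ge-\alpha_2z^{-s-2}$ for all $z>r_{\rm hc}$, and $v''(z_{\max})+\sum_{n=2}^\infty n^2v''(nz_{\min})>0$. Energy: for $z_1,\ldots,z_{N-1}>0$, $$\mathcal E_N(z_1,\ldots,z_{N-1})=\sum_{1\le i<j\le N,\ |i-j|\le m}v(z_i+\cdots+z_{j-1})+p\sum_{j=1}^{N-1}z_j,\qquad E_N=\inf_{z_1,\ldots,z_{N-1}>0}\mathcal E_N(z_1,\ldots,z_{N-1}).$$ *)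

(* Defs.v *)
From HB Require Import structures.
From mathcomp Require Import all_boot all_order all_algebra.
From mathcomp Require Import all_classical all_reals all_analysis.

Set Implicit Arguments.
Unset Strict Implicit.
Unset Printing Implicit Defensive.

Import Order.TTheory GRing.Theory Num.Theory.
Import numFieldNormedType.Exports.

Local Open Scope classical_set_scope.
Local Open Scope ring_scope.
Local Open Scope ereal_scope.

Definition minimizer (R : realType) (T : Type) (A : set T) (f : T -> \bar R)
    (x : T) : Prop :=
  A x /\ forall y, A y -> f x <= f y.

Definition unique_minimizer (R : realType) (T : Type) (A : set T)
    (f : T -> \bar R) (x : T) : Prop :=
  unique (minimizer A f) x.

Definition pos_reals (R : realType) : set R := [set r | (0 < r)%R].
Arguments pos_reals R : clear implicits.

(* A potential on (0, +oo) with values in R u {+oo} is a function R -> \bar R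
   whose values on the non-positive reals are never constrained nor used.
   Derivatives are those of its real part; they are only used at points
   z > rhc >= 0, in a neighbourhood of which the potential is finite. *)
Definition vreal (R : realType) (v : R -> \bar R) : R -> R :=
  fun z => fine (v z).

Definition d2 (R : realType) (v : R -> \bar R) : R -> R :=
  derive1n 2 (vreal v).

(* Increasing and decreasing are meant in the wide sense: the potential is
   constant, equal to +oo, on (0, rhc]. *)
Record assumptionV (R : realType) (v : R -> \bar R)
    (rhc zmin zmax alpha1 alpha2 s : R) : Prop := AssumptionV {
  V_rhc_ge0 : (0 <= rhc)%R ;
  V_hard_core : forall z : R, (0 < z)%R -> (z <= rhc)%R -> v z = +oo ;
  V_finite : forall z : R, (rhc < z)%R -> v z \is a fin_num ;
  V_C2 : forall z : R, (rhc < z)%R ->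
    [/\ derivable (vreal v) z 1,
        derivable (derive1 (vreal v)) z 1 &
        {for z, continuous (d2 v)}] ;
  V_rhc_zmin : (rhc < zmin)%R ;
  V_zmin_zmax : (zmin < zmax)%R ;
  V_zmax_2zmin : (zmax < 2 * zmin)%R ;
  V_alpha1 : (0 < alpha1)%R ;
  V_alpha2 : (0 < alpha2)%R ;
  V_s : (2 < s)%R ;
  V_zmax_minimizer : unique_minimizer (pos_reals R) v zmax ;
  V_zmax_neg : v zmax < 0 ;
  V_decreasing : forall x y : R,
    (0 < x)%R -> (x <= y)%R -> (y < zmax)%R -> v y <= v x ;
  V_increasing : forall x y : R, (zmax < x)%R -> (x <= y)%R -> v x <= v y ;
  V_nonpos : forall z : R, (zmax < z)%R -> v z <= 0 ;
  V_lower : forall z : R, (0 < z)%R -> (- (alpha1 * z `^ (- s)))%:E <= v z ;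
  V_core : forall z : R, (0 < z)%R -> (z < zmin)%R ->
    0 < v z + v zmax
        - (2 * alpha1)%:E * \sum_(2 <= n <oo) ((n%:R * z) `^ (- s))%:E ;
  V_d2_decreasing : forall x y : R,
    (zmin <= x)%R -> (x <= y)%R -> (y <= zmax)%R ->
    (d2 v y <= d2 v x)%R ;
  V_d2_increasing : forall x y : R,
    (2 * zmin <= x)%R -> (x <= y)%R ->
    (d2 v x <= d2 v y)%R ;
  V_d2_nonpos : forall z : R,
    (2 * zmin <= z)%R -> (d2 v z <= 0)%R ;
  V_d2_lower : forall z : R, (rhc < z)%R ->
    (- (alpha2 * z `^ (- s - 2)) <= d2 v z)%R ;
  V_d2_pos :
    0 < (d2 v zmax)%:E
        + \sum_(2 <= n <oo) (n%:R ^+ 2 * d2 v (n%:R * zmin))%:E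
}.

(* The interaction range m in {1, 2, ...} u {oo} is an [option nat] different
   from [Some 0]; [None] stands for oo. *)
Definition in_range (m : option nat) (d : nat) : bool :=
  if m is Some m0 then (d <= m0)%N else true.

(* The particles are numbered 0, ..., N - 1, and z 0 k is the spacing between
   the particles k and k + 1, i.e. z_{k+1} in one-based numbering. *)
Definition energy (R : realType) (v : R -> \bar R) (m : option nat) (p : R)
    (N : nat) (z : 'rV[R]_N.-1) : \bar R :=
  \sum_(i < N) \sum_(j < N | (i < j)%N && in_range m (j - i))
     v (\sum_(k < N.-1 | (i <= k < j)%N) z ord0 k)%R
  + (p * \sum_(k < N.-1) z ord0 k)%:E.

Definition pos_spacings (R : realType) (N : nat) : set 'rV[R]_N.-1 :=
  [set z | forall k, (0 < z ord0 k)%R].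
Arguments pos_spacings R N : clear implicits.

Definition ground_energy (R : realType) (v : R -> \bar R) (m : option nat)
    (p : R) (N : nat) : \bar R :=
  ereal_inf [set energy v m p z | z in pos_spacings R N].

Definition bulk_energy (R : realType) (v : R -> \bar R) (m : option nat)
    (p : R) (r : R) : \bar R :=
  (p * r)%:E +
  (if m is Some m0 then \sum_(1 <= k < m0.+1) v (k%:R * r)%R
   else \sum_(1 <= k <oo) v (k%:R * r)%R).

(* Main.v *)
(** Clipping spacings larger than [zmax], and moving to the end of the chain a
particle whose right spacing is the smallest one and less than [zmin], strictly
lowers the energy; hence all minimizers lie in the box [[zmin, zmax]^(N-1)],
where a minimizer exists by compactness.

Uniqueness and bulk behaviour come from the Euler-Lagrange equations. Subtract
the equations of two critical chains at one spacing each. The nearest-neighbour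
term expands the difference of the two spacings by at least [v''(zmax)], while
the other terms contribute at most [Q M], where [M] bounds the differences of
the surrounding spacings and [Q = - sum_(k >= 2) k^2 v''(k zmin) < v''(zmax)].
For two minimizers of the same energy this is a maximum principle. For chains of
different lengths, cutting off far pairs costs a summable tail, and iterating the
contraction away from the ends shows that the spacings in the bulk are uniformly
Cauchy, so that they converge to some [a].

The energy per particle of box chains whose bulk spacings converge to [r] tends
to the bulk energy of [r]. Comparing minimizers with equispaced chains shows
that [a] minimizes the bulk energy among [r] in [[zmin, zmax]]; strict midpoint
convexity there and direct estimates elsewhere give uniqueness. *)

Require Import Defs.
From HB Require Import structures.
From mathcomp Require Import all_boot all_order all_algebra.
From mathcomp Require Import all_classical all_reals all_analysis.
From mathcomp Require Import zify ring lra.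

Set Implicit Arguments.
Unset Strict Implicit.
Unset Printing Implicit Defensive.

Import Order.TTheory GRing.Theory Num.Theory.
Import numFieldNormedType.Exports.

Local Open Scope classical_set_scope.
Local Open Scope ring_scope.

(** * Sums, real-valued potentials and distances along a chain *)

Lemma ltr_sum_single (R : numDomainType) (I : finType) (P : pred I)
    (F G : I -> R) (i0 : I) :
  P i0 -> (forall i, P i -> F i <= G i) -> F i0 < G i0 ->
  \sum_(i | P i) F i < \sum_(i | P i) G i.
Proof.
move=> Pi0 leFG ltFG; rewrite (bigD1 i0)//= [ltRHS](bigD1 i0)//=.
by apply: ltr_leD => //; apply: ler_sum => i /andP[/leFG].
Qed.

Lemma ler_sum_widen (R : numDomainType) (F : nat -> R) a n n' :
  (forall k, 0 <= F k) -> (n <= n')%N ->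
  \sum_(a <= k < n) F k <= \sum_(a <= k < n') F k.
Proof.
move=> F0 nn'; have [an|na] := leqP a n; last first.
  by rewrite big_geq ?sumr_ge0// ltnW.
by rewrite (big_cat_nat an nn') lerDl sumr_ge0.
Qed.

Section potential.
Variable R : realType.
Implicit Types (x y : nat -> R).

(* Real-valued form of the assumption, with [w1 = w'] and [w2 = w'']. [tau k r]
   stands for [alpha1 * (k * r) ^ (- s)] and [lam k] for [tau k (zmin / 2)]. *)
Record chain_potential (w w1 w2 : R -> R) (rhc zmin zmax Q : R)
    (tau : nat -> R -> R) (lam : nat -> R) : Prop := ChainPotential {
  cp_rhc : 0 <= rhc ;
  cp_rz : rhc < zmin ;
  cp_zz : zmin < zmax ;
  cp_z2 : zmax < 2 * zmin ;
  cp_d1 : forall z, rhc < z -> is_derive z 1 w (w1 z) ;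
  cp_d2 : forall z, rhc < z -> is_derive z 1 w1 (w2 z) ;
  cp_min : forall z, rhc < z -> z != zmax -> w zmax < w z ;
  cp_neg : w zmax < 0 ;
  cp_dec : forall a b, rhc < a -> a <= b -> b <= zmax -> w b <= w a ;
  cp_inc : forall a b, zmax <= a -> a <= b -> w a <= w b ;
  cp_nonpos : forall a, zmax <= a -> w a <= 0 ;
  cp_tau0 : forall k r, 0 <= tau k r ;
  cp_low : forall k r d, (2 <= k)%N -> rhc < r -> r <= zmin ->
    k%:R * r <= d -> - tau k r <= w d ;
  cp_core : forall n r, rhc < r -> r < zmin ->
    2 * \sum_(2 <= k < n) tau k r < w r + w zmax ;
  cp_core_zmin : forall n,
    2 * \sum_(2 <= k < n) tau k zmin <= w zmin + w zmax ;
  cp_lam0 : forall k, 0 <= lam k ;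
  cp_lam : forall k d, (0 < k)%N -> rhc < d -> k%:R * (zmin / 2) <= d ->
    - lam k <= w d ;
  cp_lamS : exists C, forall n, \sum_(0 <= k < n) lam k <= C ;
  cp_w2dec : forall a b, zmin <= a -> a <= b -> b <= zmax -> w2 b <= w2 a ;
  cp_w2inc : forall a b, 2 * zmin <= a -> a <= b -> w2 a <= w2 b ;
  cp_w2np : forall a, 2 * zmin <= a -> w2 a <= 0 ;
  cp_Q : forall n, \sum_(2 <= k < n) k%:R ^+ 2 * - w2 (k%:R * zmin) <= Q ;
  cp_QK : Q < w2 zmax
}.

(** A chain is given by positions on all of [nat], of which the first [N] enter; differences of
    positions replace sums of spacings. *)
Definition chain_energy (w : R -> R) (m : option nat) (p : R) (N : nat)
    (x : nat -> R) : R :=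
  \sum_(i < N) \sum_(j < N | (i < j)%N && in_range m (j - i)) w (x j - x i)
  + p * (x N.-1 - x 0%N).

(** Demanded at every index, also beyond the last particle, so that it does not depend on [N]; by
    [chain_energy_eq] the spacings beyond the last particle may be changed freely. *)
Definition box (zmin zmax : R) (x : nat -> R) :=
  forall l, zmin <= x l.+1 - x l <= zmax.

Lemma dist_ge x (b : R) i k :
  (forall l, (i <= l < i + k)%N -> b <= x l.+1 - x l) ->
  k%:R * b <= x (i + k)%N - x i.
Proof.
elim: k => [|k IH] H; first by rewrite mul0r addn0 subrr.
have := H (i + k)%N; rewrite leq_addr addnS ltnS leqnn => /(_ isT) H1.
have : k%:R * b <= x (i + k)%N - x i.
  by apply: IH => l /andP[il lk]; apply: H; rewrite il addnS ltnS ltnW.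
by rewrite -natr1; lra.
Qed.

Lemma dist_le x (b : R) i k :
  (forall l, (i <= l < i + k)%N -> x l.+1 - x l <= b) ->
  x (i + k)%N - x i <= k%:R * b.
Proof.
elim: k => [|k IH] H; first by rewrite mul0r addn0 subrr.
have := H (i + k)%N; rewrite leq_addr addnS ltnS leqnn => /(_ isT) H1.
have : x (i + k)%N - x i <= k%:R * b.
  by apply: IH => l /andP[il lk]; apply: H; rewrite il addnS ltnS ltnW.
by rewrite -natr1; lra.
Qed.

Lemma dist_ge_nat x (b : R) i j : (i <= j)%N ->
  (forall l, (i <= l < j)%N -> b <= x l.+1 - x l) ->
  (j - i)%:R * b <= x j - x i.
Proof.
by move=> ij H; rewrite -[in x j](subnKC ij); apply: dist_ge => l;
  rewrite subnKC// => /H.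
Qed.

Lemma dist_eq x y i j : (i <= j)%N ->
  (forall l, (i <= l < j)%N -> x l.+1 - x l = y l.+1 - y l) ->
  x j - x i = y j - y i.
Proof.
move=> ij; rewrite -(subnKC ij); elim: (j - i)%N => [|k IH] H.
  by rewrite addn0 !subrr.
have := H (i + k)%N; rewrite leq_addr addnS ltnS leqnn => /(_ isT) H1.
have : x (i + k)%N - x i = y (i + k)%N - y i.
  by apply: IH => l Hl; apply: H; lia.
lra.
Qed.

Lemma chain_energy_eq w1 m p N x y :
  (forall l, (l.+1 < N)%N -> x l.+1 - x l = y l.+1 - y l) ->
  chain_energy w1 m p N x = chain_energy w1 m p N y.
Proof.
move=> H; rewrite /chain_energy; congr (_ + _).
  apply: eq_bigr => i _; apply: eq_bigr => j /andP[ij _].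
  congr w1; apply: dist_eq; first exact: ltnW.
  by move=> l /andP[_ lj]; apply: H; rewrite (leq_ltn_trans lj).
congr (p * _); apply: dist_eq => // l /andP[_ lN]; apply: H; lia.
Qed.

End potential.

(** * Reduction to the box *)

Section removal.
Context {R : realType}.
Variables (w w1 w2 : R -> R) (rhc zmin zmax Q : R).
Variables (tau : nat -> R -> R) (lam : nat -> R).
Hypothesis hw : chain_potential w w1 w2 rhc zmin zmax Q tau lam.
Variables (m : option nat) (p : R).
Hypotheses (hm : m <> Some 0%N) (p0 : 0 <= p).

Local Notation E := (chain_energy w m p).

Definition pair_energy (x : nat -> R) i j : R :=
  if (i < j)%N && in_range m (j - i) then w (x j - x i) else 0.

Lemma in_range1 : in_range m 1.
Proof. by move: hm; case: m => //= -[]. Qed.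

Lemma in_range_le d d' : (d' <= d)%N -> in_range m d -> in_range m d'.
Proof. by case: m => //= m0 h /(leq_trans h). Qed.

Lemma cp_min_le z : rhc < z -> w zmax <= w z.
Proof.
move=> rz; have [->//|zN] := eqVneq z zmax.
exact/ltW/(cp_min hw).
Qed.

(** A distance that contains no clipped spacing is unchanged; any other one is still at least [zmax]
    after clipping, and [w] increases there. Strictness comes from the clipped nearest-neighbour
    pair, since [zmax] is the only minimizer of [w]. *)
Lemma energy_clip_le N x y :
  (forall l, rhc < x l.+1 - x l) ->
  (forall l, y l.+1 - y l = Num.min (x l.+1 - x l) zmax) ->
  E N y <= E N x /\
  (forall l, (l.+1 < N)%N -> zmax < x l.+1 - x l -> E N y < E N x).
Proof.
move=> rx yE.
have rhc0 := cp_rhc hw; have rz := cp_rz hw; have zz := cp_zz hw.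
have dst i k : y (i + k)%N - y i = x (i + k)%N - x i \/
    zmax <= y (i + k)%N - y i <= x (i + k)%N - x i.
  elim: k => [|k IH]; first by rewrite addn0 !subrr; left.
  have := rx (i + k)%N; have := yE (i + k)%N; rewrite -addnS.
  have y0 : 0 <= y (i + k)%N - y i.
    have := @dist_ge _ y 0 i k; rewrite mulr0; apply=> l _.
    by rewrite yE; have := rx l; rewrite minEle; case: ifP => _; lra.
  rewrite minEle; case: ifPn => [H1 H2 H3|]; last rewrite -ltNge => H1 H2 H3.
    by case: IH => [IH|/andP[IH1 IH2]]; [left; lra|right; apply/andP; split; lra].
  right; case: IH => [IH|/andP[IH1 IH2]]; apply/andP; split; lra.
have dstn i j : (i < j)%N -> y j - y i = x j - x i \/
    zmax <= y j - y i <= x j - x i.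
  by move=> ij; have := dst i (j - i)%N; rewrite subnKC // ltnW.
have wle i j : (i < j)%N -> w (y j - y i) <= w (x j - x i).
  by move=> /dstn [->//|/andP[]]; exact: (cp_inc hw).
have ple : p * (y N.-1 - y 0%N) <= p * (x N.-1 - x 0%N).
  apply: ler_wpM2l => //; have := dst 0%N N.-1; rewrite add0n.
  by case=> [->//|/andP[_]].
split.
  by apply: lerD => //; apply: ler_sum => i _; apply: ler_sum => j /andP[/wle].
move=> l lN xl; apply: ltr_leD => //.
have lN' := ltnW lN.
apply: (ltr_sum_single (i0 := Ordinal lN')) => //.
  by move=> i _; apply: ler_sum => j /andP[/wle].
apply: (ltr_sum_single (i0 := Ordinal lN)) => /=.
- by rewrite ltnSn subSnn in_range1.
- by move=> j /andP[/wle].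
rewrite yE; have -> : Num.min (x l.+1 - x l) zmax = zmax by apply/min_idPr/ltW.
apply: (cp_min hw); [lra|by rewrite gt_eqF].
Qed.

(** Identifies the pairs that enter the range when a deletion lowers their index distance from
    [d.+1] to [d]. *)
Lemma in_range_last d : in_range m d && ~~ in_range m d.+1 = (m == Some d).
Proof.
case: m => //= m0; rewrite -ltnNge ltnS -eqn_leq eq_sym.
by apply/eqP/eqP => [->|[]].
Qed.

(* Deleting the particle [q] brings pairs at index distance [m + 1] into the
   interaction range. For each particle [i < q] there is at most one such new
   pair; as its distance exceeds that from [i] to [q], its energy is at most the
   positive part of the energy of the deleted pair [(i, q)]. *)
Lemma energy_remove_row N x q i :
  (forall l, rhc < x l.+1 - x l) -> (q < N)%N -> (i < q)%N ->
  \sum_(j < N | (i < j)%N && in_range m (j - i)) w (x (bump q j) - x i)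
   + Num.min 0 (w (x q - x i)) * (in_range m (q - i))%:R
  <= pair_energy x i q + \sum_(j < N) pair_energy x i (bump q j).
Proof.
move=> rx qN iq; set f := pair_energy x.
have rhc0 := cp_rhc hw.
have xlt a b : (a < b)%N -> rhc < x b - x a.
  move=> ab; have := @dist_ge_nat _ x (x a.+1 - x a) a a.+1.
  have := @dist_ge_nat _ x rhc a.+1 b ab.
  have H : rhc < x a.+1 - x a by exact: rx.
  have : 0 <= (b - a.+1)%:R * rhc :> R by rewrite mulr_ge0.
  by move=> ? /(_ (fun l _ => ltW (rx l))) ? _; lra.
set M := Num.max 0 (w (x q - x i)).
have M0 : 0 <= M by rewrite le_max lexx.
have Hj (j : 'I_N) :
   (if (i < j)%N && in_range m (j - i) then w (x (bump q j) - x i) else 0)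
   - (if (q <= j)%N && (m == Some (j - i)%N) then M else 0) <= f i (bump q j).
  rewrite /f /pair_energy /bump; have [qj|jq] := leqP q j; last by rewrite add0n subr0.
  rewrite add1n.
  have ij : (i < j)%N by lia.
  rewrite ij ltnS (ltnW ij) /= subSn; last exact: ltnW.
  rewrite -in_range_last.
  case r1: (in_range m (j - i)%N); case r2: (in_range m (j - i).+1) => /=;
    rewrite ?subr0 ?subrr//; last first.
    by move: r1; rewrite (in_range_le (leqnSn _) r2).
  rewrite subr_le0 /M le_max.
  have [le|gt] := lerP zmax (x j.+1 - x i); first by rewrite (cp_nonpos hw).
  apply/orP; right; apply: (cp_dec hw) => //; [exact: xlt| |exact: ltW].
  have : rhc < x j.+1 - x q by apply: xlt.
  lra.
have HS : \sum_(j < N) (if (q <= j)%N && (m == Some (j - i)%N) then M else 0)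
    <= M * (in_range m (q - i))%:R.
  case: (m) => [m0|]; last first.
    by rewrite big1 ?mulr1// => j _; rewrite andbF.
  have [j0 /andP[qj0 /eqP[m0E]]|none] := pickP (fun j : 'I_N =>
    (q <= j)%N && (Some m0 == Some (j - i)%N)); last first.
    by rewrite big1 ?mulr_ge0// => j _; rewrite none.
  rewrite (bigD1 j0)//= qj0 m0E eqxx big1 => [|j jj0].
    by rewrite addr0 leq_sub2r// mulr1.
  case: ifPn => // /andP[qj /eqP[jE]]; move/eqP: jj0; case.
  by apply: val_inj; rewrite /=; move: iq qj qj0 jE; lia.
rewrite big_mkcond /=.
have := @ler_sum _ _ (index_enum 'I_N) xpredT _ _ (fun j _ => Hj j).
rewrite sumrB => HJ.
have fq : f i q = w (x q - x i) * (in_range m (q - i))%:R.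
  by rewrite /f /pair_energy iq; case: in_range; rewrite ?mulr1 ?mulr0.
(* Only the positive part [M] of the deleted pair pays for the new pair; the negative part stays on
   the left of the claim. *)
have minM : Num.min 0 (w (x q - x i)) + M = w (x q - x i).
  by rewrite addr_min_max add0r.
have : Num.min 0 (w (x q - x i)) * (in_range m (q - i))%:R + 
  M * (in_range m (q - i))%:R = f i q by rewrite fq -mulrDl minM.
lra.
Qed.

Lemma sum_rev_dist (H : nat -> R) q :
  \sum_(i < q) H (q - i)%N = \sum_(1 <= k < q.+1) H k.
Proof.
rewrite big_add1 /= big_mkord [RHS](reindex_inj rev_ord_inj) /=.
by apply: eq_bigr => i _; congr H; have := ltn_ord i; lia.
Qed.

(** Let [r] be the least spacing, between [q] and [q.+1]. The pairs of [q] with particles on its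
    right have energy at least [w r - T], since [k] spacings are at least [k * r] long. On the left,
    the positive parts pay for the pairs entering the range, and the negative parts add up to at
    least [w zmax - T]. The total [w r + w zmax - 2 * T] is positive by [cp_core]. *)
Lemma energy_remove_lt N x q :
  (forall l, rhc < x l.+1 - x l) -> (q < N)%N -> x q.+1 - x q < zmin ->
  (forall l, (l < N)%N -> x q.+1 - x q <= x l.+1 - x l) ->
  E N (x \o bump q) < E N.+1 x.
Proof.
move=> rx qN rq rmin.
set r := x q.+1 - x q in rq rmin *.
have rr : rhc < r by exact: rx.
have rhc0 := cp_rhc hw.
have inc a b : (a <= b)%N -> x a <= x b.
  move=> ab; have := @dist_ge_nat _ x 0 a b ab; rewrite mulr0 subr_ge0; apply.
  by move=> l _; have := rx l; lra.
have dge a b : (a <= b)%N -> (b <= N)%N -> (b - a)%:R * r <= x b - x a.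
  by move=> ab bN; apply: dist_ge_nat => // l ?; apply: rmin; lia.
set T := \sum_(2 <= k < N.+1) tau k r.
have core := cp_core hw N.+1 rr rq; rewrite -/T in core.
set A : R := \sum_(j < N.+1) pair_energy x q j.
have AE : w r - T <= A.
  rewrite /A -(big_mkord xpredT (pair_energy x q)).
  rewrite (big_cat_nat (n := q.+1)) //=; last by lia.
  rewrite big_nat big1 ?add0r; last first.
    by move=> j Hj; rewrite /pair_energy; have -> : (q < j)%N = false by lia.
  rewrite big_ltn ?ltnS//.
  have -> : pair_energy x q q.+1 = w r.
    by rewrite /pair_energy ltnSn subSnn in_range1.
  apply: lerD => //; rewrite /T -sumrN.
  apply: (@le_trans _ _ (\sum_(q.+2 <= j < N.+1) - tau (j - q)%N r)).
    rewrite !sumrN lerN2 -[q.+2]/(2 + q)%N big_addn.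
    rewrite (eq_bigr (tau^~ r)); last by move=> k _; rewrite addnK.
    by apply: ler_sum_widen => [k|]; [exact: (cp_tau0 hw)|lia].
  apply: ler_sum_nat => j ?; rewrite /pair_energy.
  case: ifP => _; last by rewrite oppr_le0 (cp_tau0 hw).
  apply: (cp_low hw) => //; [lia|exact: ltW|apply: dge; lia].
set B : R := \sum_(i < N) (Num.min 0 (w (x q - x i)) * (in_range m (q - i))%:R) *+ (i < q)%N.
have BE : w zmax - T <= B.
  (* [- H k] bounds from below the negative part of the pair at index distance [k] on the left of
     [q]. As [H] is nonnegative, the sum may run up to [N] even if fewer particles lie there. *)
  pose H k := if k == 1%N then - w zmax else tau k r.
  have H0 k : 0 <= H k.
    by rewrite /H; case: eqP => _; [have := cp_neg hw; lra|exact: (cp_tau0 hw)].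
  have -> : w zmax - T = - \sum_(1 <= k < N.+1) H k.
    rewrite big_ltn; last by lia.
    rewrite opprD /H /= opprK; congr (_ - _).
    by apply: eq_big_nat => k /andP[k2 _]; case: eqP => // kE; rewrite kE in k2.
  apply: (@le_trans _ _ (- \sum_(1 <= k < q.+1) H k)).
    by rewrite lerN2; apply: ler_sum_widen => //; rewrite ltnS ltnW.
  rewrite -sum_rev_dist (big_ord_widen _ (fun i => H (q - i)%N) (ltnW qN)) big_mkcond -sumrN.
  apply: ler_sum => i _; case: ifPn => iq; last by rewrite oppr0.
  have Hi : - H (q - i)%N <= w (x q - x i).
    rewrite /H; case: eqP => [qi1|qi1].
      rewrite opprK; apply: cp_min_le.
      have -> : q = i.+1 by lia.
      exact: rx.
    apply: (cp_low hw) => //; [lia|exact: ltW|apply: dge; lia].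
  rewrite mulr1n; case: in_range; rewrite ?mulr1 ?mulr0 ?oppr_le0//.
  by rewrite le_min Hi oppr_le0 H0.
have CE : \sum_(i < N) \sum_(j < N | (i < j)%N && in_range m (j - i))
    w ((x \o bump q) j - (x \o bump q) i) + B
  <= \sum_(i < N) (pair_energy x (bump q i) q +
       \sum_(j < N) pair_energy x (bump q i) (bump q j)).
  rewrite /B -big_split; apply: ler_sum => i _ /=.
  (* Rows [i >= q] keep their index distances, since both indices shift; only rows [i < q] need
     [energy_remove_row]. *)
  have [iq|qi] := ltnP i q.
    rewrite [bump q i]/bump leqNgt iq add0n mulr1n.
    exact: energy_remove_row.
  rewrite mulr0n addr0 [X in _ <= X + _]/pair_energy /bump qi add1n.
  rewrite ltnNge (leq_trans qi) ?add0r; last exact: leqnSn.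
  rewrite big_mkcond /=; apply: ler_sum => j _; rewrite /pair_energy.
  have [qj|jq] := leqP q j; first by rewrite add1n ltnS subSS.
  rewrite add0n; have -> : (i < j)%N = false by lia.
  by have -> : (i.+1 < j)%N = false by lia.
have EE : \sum_(i < N.+1) \sum_(j < N.+1 | (i < j)%N && in_range m (j - i)) w (x j - x i)
  = A + \sum_(i < N) (pair_energy x (bump q i) q +
       \sum_(j < N) pair_energy x (bump q i) (bump q j)).
  have qN1 : (q < N.+1)%N by lia.
  rewrite (bigD1_ord (Ordinal qN1)) //=; congr (_ + _).
    by rewrite /A big_mkcond.
  apply: eq_bigr => i _.
  rewrite big_mkcond (bigD1_ord (Ordinal qN1)) //=.
rewrite /chain_energy EE.
have : p * ((x \o bump q) N.-1 - (x \o bump q) 0%N) <= p * (x N.+1.-1 - x 0%N).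
  apply: ler_wpM2l => //=; apply: lerB; apply: inc => //.
  by rewrite /bump; case: leqP; lia.
lra.
Qed.

(** The new particle has energy [w zmax] with its neighbour and nonpositive energy with all others,
    which are at least [zmax] away. *)
Lemma energy_append N x : (forall l, 0 <= x l.+1 - x l) ->
  x N.+1 - x N = zmax -> E N.+2 x <= E N.+1 x + (p * zmax + w zmax).
Proof.
move=> xmon xN; rewrite /chain_energy /=.
have -> : x N.+1 - x 0%N = zmax + (x N - x 0%N) by lra.
suff : \sum_(i < N.+2) \sum_(j < N.+2 | (i < j)%N && in_range m (j - i)) w (x j - x i)
  <= \sum_(i < N.+1) \sum_(j < N.+1 | (i < j)%N && in_range m (j - i))
     w (x j - x i) + w zmax by lra.
rewrite big_ord_recr /= [X in _ + X]big1 ?addr0; last first.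
  by move=> j /andP[/= Hj _]; have := ltn_ord j; lia.
have far i : (i < N.+1)%N -> w (x N.+1 - x i) <= 0.
  move=> iN; apply: (cp_nonpos hw).
  have := @dist_ge_nat _ x 0 i N; rewrite mulr0 => /(_ _ _) H.
  have : 0 <= x N - x i by apply: H => // l _; exact: xmon.
  lra.
rewrite big_ord_recr [in leRHS]big_ord_recr /= -addrA; apply: lerD.
  apply: ler_sum => i _; rewrite big_mkcond big_ord_recr /= -big_mkcond /=.
  rewrite gerDl; case: ifP => // _; exact/far/leqW/ltn_ord.
rewrite big_mkcond big_ord_recr /= -big_mkcond /= ltnSn subSnn in_range1/=.
by rewrite xN.
Qed.

End removal.

Section box_minimization.
Context {R : realType}.
Variables (w w1 w2 : R -> R) (rhc zmin zmax Q : R).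
Variables (tau : nat -> R -> R) (lam : nat -> R).
Hypothesis hw : chain_potential w w1 w2 rhc zmin zmax Q tau lam.
Variables (m : option nat) (p : R).
Hypotheses (hm : m <> Some 0%N) (p0 : 0 <= p) (pneg : p * zmax + w zmax < 0).
Local Notation E := (chain_energy w m p).

(* Clip the spacings to [zmax]; if the least one is then smaller than [zmin],
   delete the particle on its left and append one at distance [zmax] on the
   right of the box configuration given by induction. *)
Lemma energy_box_le N x : (forall l, rhc < x l.+1 - x l) ->
  exists y, [/\ box zmin zmax y, E N y <= E N x &
    forall l, (l.+1 < N)%N -> ~~ (zmin <= x l.+1 - x l <= zmax) ->
      E N y < E N x].
Proof.
have rz := cp_rz hw; have zz := cp_zz hw.
have pos_sum (f : nat -> R) l :
    \sum_(k < l.+1) f k - \sum_(k < l) f k = f l by rewrite big_ord_recr/= addrAC subrr add0r.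
have box_mk (f : nat -> R) : (forall l, zmin <= f l <= zmax) ->
    box zmin zmax (fun n => \sum_(k < n) f k).
  by move=> H l; rewrite (pos_sum f).
elim: N x => [|N IH] x rx.
  exists (fun n => \sum_(k < n) zmax); split => //.
    by apply: (box_mk (fun=> zmax)) => _; rewrite lexx ltW.
  by rewrite /chain_energy !big_ord0 !subrr.
pose y n : R := \sum_(k < n) Num.min (x k.+1 - x k) zmax.
have yE l : y l.+1 - y l = Num.min (x l.+1 - x l) zmax
  by exact: (pos_sum (fun k => Num.min (x k.+1 - x k) zmax)).
have [Eyx Eyx_lt] := energy_clip_le hw hm p0 N.+1 rx yE.
have ry l : rhc < y l.+1 - y l by rewrite yE lt_min rx; lra.
have yzmax l : y l.+1 - y l <= zmax by rewrite yE ge_min lexx orbT.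
have [[q qN /andP[qmin qz]]|yok] :
    (exists2 q, (q < N)%N & [forall l : 'I_N, y q.+1 - y q <= y l.+1 - y l]
        && (y q.+1 - y q < zmin)) \/
    (forall l, (l < N)%N -> zmin <= y l.+1 - y l).
- case: N {IH Eyx Eyx_lt} => [|N]; first by right.
  pose q := [arg min_(q < ord0 : 'I_N.+1) (y q.+1 - y q)%R]%O.
  have qmin (l : 'I_N.+1) : y q.+1 - y q <= y l.+1 - y l.
    by rewrite /q; case: arg_minP => //= i _; apply.
  have [qz|zq] := ltrP (y q.+1 - y q) zmin.
    by left; exists q => //; rewrite qz andbT; apply/forallP.
  by right => l lN; apply: le_trans zq (qmin (Ordinal lN)).
- have rmy : E N (y \o bump q) < E N.+1 y.
    apply: (energy_remove_lt hw hm p0) => // l lN.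
    exact: (forallP qmin (Ordinal lN)).
  have rb l : rhc < (y \o bump q) l.+1 - (y \o bump q) l.
    rewrite /= /bump; have [ql|lq] := leqP q l.
      by rewrite (leqW ql) !add1n ry.
    have [ql1|lq1] := leqP q l.+1; last by rewrite !add0n ry.
    rewrite add1n add0n; have := ry l; have := ry l.+1; have := cp_rhc hw.
    lra.
  have [u [ubox uE _]] := IH _ rb.
  (* The [N] particles of [u] use the spacings [k] with [k.+1 < N]; the next spacing is that of the
     appended particle. *)
  pose t n : R := \sum_(k < n) if (k.+1 < N)%N then u k.+1 - u k else zmax.
  have tE l : t l.+1 - t l = if (l.+1 < N)%N then u l.+1 - u l else zmax
    by exact: (pos_sum (fun k => if (k.+1 < N)%N then u k.+1 - u k else zmax)).
  have tbox : box zmin zmax t.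
    apply: (box_mk (fun k => if (k.+1 < N)%N then u k.+1 - u k else zmax)) => l.
    by case: ifP => _; rewrite ?ubox// lexx ltW.
  have tu : E N t = E N u.
    by apply: chain_energy_eq => l lN; rewrite tE lN.
  have tN : E N.+1 t <= E N t + (p * zmax + w zmax).
    have tmon l : 0 <= t l.+1 - t l.
      by have /andP[] := tbox l; have := cp_rhc hw; lra.
    move: qN tE; case: (N) => // N' _ tE'; apply: (energy_append hw hm) => //.
    by rewrite tE' ltnn.
  have lt : E N.+1 t < E N.+1 x.
    apply: lt_le_trans Eyx; apply: le_lt_trans tN _; rewrite tu.
    have := le_lt_trans uE rmy; apply: le_lt_trans.
    by rewrite gerDl ltW.
  by exists t; split => //; exact: ltW.
(* The first [N] spacings of [y] are already at least [zmin]; the maximum only repairs those beyond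
   the chain, because [box] concerns all indices. *)
pose t n : R := \sum_(k < n) Num.max zmin (y k.+1 - y k).
have tE l : t l.+1 - t l = Num.max zmin (y l.+1 - y l)
  by exact: (pos_sum (fun k => Num.max zmin (y k.+1 - y k))).
have ty : E N.+1 t = E N.+1 y.
  by apply: chain_energy_eq => l lN; rewrite tE; apply/max_idPr/yok; rewrite -ltnS.
exists t; rewrite ty; split => //.
  apply: (box_mk (fun k => Num.max zmin (y k.+1 - y k))) => l.
  by rewrite le_max lexx /= ge_max yzmax ltW.
(* By [yok] no spacing of [x] in the chain is below [zmin], so one outside the box exceeds [zmax]
   and clipping is strict. *)
move=> l lN; rewrite negb_and -!ltNge => /orP[xl|]; last exact: Eyx_lt.
have := yok l; rewrite -ltnS => /(_ lN); rewrite yE le_min => /andP[]; lra.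
Qed.

End box_minimization.

(** * Derivatives of the potential *)

Section derivatives.
Context {R : realType}.
Variables (w w1 w2 : R -> R) (rhc zmin zmax Q : R).
Variables (tau : nat -> R -> R) (lam : nat -> R).
Hypothesis hw : chain_potential w w1 w2 rhc zmin zmax Q tau lam.

Lemma MVT_above (f df : R -> R) (c a b : R) :
  (forall z, c < z -> is_derive z 1 f (df z)) -> c < a -> a < b ->
  exists2 t, a < t < b & f b - f a = df t * (b - a).
Proof.
move=> fd ca ab.
have [t tab ->] : exists2 t, t \in `]a, b[ & f b - f a = df t * (b - a).
  apply: MVT => //.
    by move=> z; rewrite in_itv /= => /andP[az _]; apply: fd; lra.
  apply: derivable_within_continuous => z; rewrite in_itv /= => /andP[az _].
  by have := fd z (lt_le_trans ca az) => ?; exact: ex_derive.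
by exists t => //; move: tab; rewrite in_itv.
Qed.

Lemma cp_continuous (z : R) : rhc < z -> {for z, continuous w}.
Proof.
move=> rz; apply: differentiable_continuous; apply/derivable1_diffP.
by have := cp_d1 hw rz => ?; exact: ex_derive.
Qed.

Lemma zmin_gt0 : 0 < zmin.
Proof. exact: le_lt_trans (cp_rhc hw) (cp_rz hw). Qed.

Lemma rhc_lt_muln k z : (0 < k)%N -> zmin <= z -> rhc < k%:R * z.
Proof.
move=> k0 zz; have zz0 := zz; have z0 := zmin_gt0; apply: lt_le_trans (cp_rz hw) _.
apply: le_trans zz _; rewrite ler_peMl// ?ler1n//.
exact: ltW (lt_le_trans z0 zz0).
Qed.

Lemma muln_2zmin k : (2 <= k)%N -> 2 * zmin <= k%:R * zmin.
Proof. by move=> k2; rewrite ler_pM2r ?zmin_gt0// ler_nat. Qed.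

(** Mean value theorem: [w2] decreases up to [zmax], so it is at least [w2 zmax] in between. *)
Lemma w1_expand a b : zmin <= a -> a <= b -> b <= zmax ->
  w2 zmax * (b - a) <= w1 b - w1 a.
Proof.
rewrite (le_eqVlt a) => za /predU1P[->|ab] bz; first by rewrite !subrr mulr0.
have [t /andP[ta tb] ->] := MVT_above (cp_d2 hw) (lt_le_trans (cp_rz hw) za) ab.
rewrite ler_pM2r ?subr_gt0//; apply: (cp_w2dec hw); lra.
Qed.

Lemma w1_dec a b : 2 * zmin <= a -> a <= b -> w1 b <= w1 a.
Proof.
rewrite (le_eqVlt a) => za /predU1P[->//|ab].
have ra : rhc < a by have := cp_rz hw; have := zmin_gt0; lra.
have [t /andP[ta tb] E1] := MVT_above (cp_d2 hw) ra ab.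
rewrite -subr_le0 E1 mulr_le0_ge0 ?subr_ge0//; last exact: ltW.
apply: (cp_w2np hw); lra.
Qed.

(** Beyond [k * zmin] the function [w2] is increasing and nonpositive, so its absolute value is
    largest at the left end. *)
Lemma w1_lipschitz k a b : (2 <= k)%N -> k%:R * zmin <= a -> k%:R * zmin <= b ->
  `|w1 a - w1 b| <= - w2 (k%:R * zmin) * `|a - b|.
Proof.
move=> k2; wlog ab : a b / a <= b => [th|].
  by case/orP: (le_total a b) => ab ka kb; [|rewrite distrC (distrC a)]; exact: th.
move=> ka kb; have kz := muln_2zmin k2.
rewrite ger0_norm ?subr_ge0 ?w1_dec//; last exact: le_trans ka.
rewrite distrC ger0_norm ?subr_ge0//.
move: ab; rewrite le_eqVlt => /predU1P[->|ab]; first by rewrite !subrr mulr0.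
have ra : rhc < a by have := cp_rz hw; have := zmin_gt0; lra.
have [t /andP[ta tb] E1] := MVT_above (cp_d2 hw) ra ab.
rewrite mulNr lerNr opprB E1 ler_pM2r ?subr_gt0//.
by apply: (cp_w2inc hw) => //; lra.
Qed.

(** If [w1 a] were negative, the decreasing function [w1] would stay negative after [a], and [w]
    could not increase there. *)
Lemma w1_ge0 a : 2 * zmin <= a -> 0 <= w1 a.
Proof.
move=> za; rewrite leNgt; apply/negP => w1a.
have ra : rhc < a by have := cp_rz hw; have := zmin_gt0; lra.
have a1 : a < a + 1 by rewrite ltrDl.
have [t /andP[ta tb] E1] := MVT_above (cp_d1 hw) ra a1.
have : w a <= w (a + 1) by apply: (cp_inc hw); have := cp_z2 hw; lra.
have := w1_dec za (ltW ta); rewrite -(subr_ge0 (w a)) E1; lra.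
Qed.

(* With [x = k * zmin], since [w1] decreases on [[x / 2, x]] and [w x <= 0],
   [x / 2 * w1 x <= w x - w (x / 2) <= - w (x / 2)]. *)
Lemma w1_lam k : (4 <= k)%N -> k%:R * w1 (k%:R * zmin) <= 2 / zmin * lam k.
Proof.
move=> k4; have z0 := zmin_gt0.
have kz : 4 * zmin <= k%:R * zmin by rewrite ler_pM2r// ler_nat.
have ra : rhc < k%:R * (zmin / 2) by have := cp_rz hw; lra.
have ab : k%:R * (zmin / 2) < k%:R * zmin by lra.
have [t /andP[ta tb] E1] := MVT_above (cp_d1 hw) ra ab.
have t1 : w1 (k%:R * zmin) <= w1 t by apply: w1_dec; [lra|exact: ltW].
have wk : w (k%:R * zmin) <= 0 by apply: (cp_nonpos hw); have := cp_z2 hw; lra.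
have wk2 : - lam k <= w (k%:R * (zmin / 2)) by apply: (cp_lam hw) => //; lia.
have : w1 (k%:R * zmin) * (k%:R * (zmin / 2)) <= lam k.
  apply: (@le_trans _ _ (w1 t * (k%:R * (zmin / 2)))).
    by rewrite ler_wpM2r// mulr_ge0// ltW// divr_gt0.
  have -> : k%:R * (zmin / 2) = k%:R * zmin - k%:R * (zmin / 2) by lra.
  rewrite -E1; lra.
move=> H; rewrite mulrAC ler_pdivlMr//; lra.
Qed.

Lemma w_tail k d : (2 <= k)%N -> k%:R * zmin <= d -> `|w d| <= lam k.
Proof.
move=> k2 kd; have z0 := zmin_gt0; have kz := muln_2zmin k2.
rewrite ler0_norm; last by apply: (cp_nonpos hw); have := cp_z2 hw; lra.
rewrite lerNl; apply: (cp_lam hw); [lia|have := cp_rz hw; lra|lra].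
Qed.

(** The second difference of [w] is the increment over [h] of the function sending [y] to
    [w (y + h) - w y]; two uses of the mean value theorem turn it into [w2 c * h ^+ 2]. *)
Lemma w_midpoint K x h : rhc < x -> 0 <= h ->
  (forall c, x <= c <= x + 2 * h -> K <= w2 c) ->
  K * h ^+ 2 <= w x + w (x + 2 * h) - 2 * w (x + h).
Proof.
move=> rx; rewrite le_eqVlt => /predU1P[<- _|h0 HK].
  by rewrite expr0n /= !mulr0 !addr0; lra.
have D z : rhc < z ->
    is_derive z 1 (fun y => w (y + h) - w y) (w1 (z + h) - w1 z).
  move=> rz.
  have rzh : rhc < z + h by lra.
  have d0 := cp_d1 hw rz.
  have d1 : is_derive (z + h) (1 : R) w (w1 (z + h)) := cp_d1 hw rzh.
  have d2 : is_derive z (1 : R) (fun y => y + h) 1.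
    by apply: is_derive_eq; rewrite addr0.
  have d3 := @is_derive1_comp _ w (fun y => y + h) z _ _ d1 d2.
  by apply: is_derive_eq; rewrite mulr1.
have xh : x < x + h by rewrite ltrDl.
have [t /andP[t1 t2] E1] := MVT_above D rx xh.
have rt : rhc < t by lra.
have th : t < t + h by rewrite ltrDl.
have [c /andP[c1 c2] E2] := MVT_above (cp_d2 hw) rt th.
have Kc : K <= w2 c by apply: HK; apply/andP; split; lra.
have -> : w x + w (x + 2 * h) - 2 * w (x + h) = w (x + h + h) - w (x + h) - (w (x + h) - w x).
  by rewrite (_ : x + h + h = x + 2 * h); lra.
rewrite E1 E2 !(addrC _ h) !addrK expr2 mulrA.
by rewrite ler_pM2r// ler_pM2r.
Qed.

End derivatives.

(** * Comparison of critical chains *)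

Section contraction.
Context {R : realType}.
Variables (w w1 w2 : R -> R) (rhc zmin zmax Q : R).
Variables (tau : nat -> R -> R) (lam : nat -> R).
Hypothesis hw : chain_potential w w1 w2 rhc zmin zmax Q tau lam.
Variable m : option nat.
Hypothesis hm : m <> Some 0%N.

(** The equation [a + b + 1 = k] has at most [k] solutions: at most [k] pairs at index distance [k]
    span a given spacing. *)
Lemma sum_pairs_le (f : nat -> R) A B : (forall k, 0 <= f k) ->
  \sum_(a < A) \sum_(b < B) f (a + b).+1 <= \sum_(0 <= k < A + B) k%:R * f k.
Proof.
move=> f0; rewrite big_mkord.
apply: (@le_trans _ _ (\sum_(a < A) \sum_(k < A + B | (a < k)%N) f k)).
  apply: ler_sum => a _; have aA := ltn_ord a.
  rewrite -(big_mkord (fun k => (a < k)%N)) /=.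
  rewrite (big_cat_nat (n := a.+1)) //=; last by lia.
  apply: ler_wpDl; first exact: sumr_ge0.
  rewrite (big_cat_nat (n := (a.+1 + B)%N)) //=; [|lia|lia].
  apply: ler_wpDr; first exact: sumr_ge0.
  rewrite -[X in index_iota X _](add0n a.+1) big_addn addKn big_mkord.
  rewrite [leRHS](eq_bigl xpredT); last by move=> b; lia.
  by apply: ler_sum => b _; rewrite addnS addnC.
rewrite (exchange_big_dep xpredT)//=; apply: ler_sum => k _.
rewrite sumr_const -[leLHS]mulr_natl ler_wpM2r// ler_nat.
have [kA|Ak] := leqP k A; last first.
  by rewrite (leq_trans (max_card _))// card_ord ltnW.
rewrite -sum1_card -(big_ord_widen _ (fun=> 1%N) kA).
by rewrite sum1_card card_ord.
Qed.

(* For [A = q.+1] and [B = N.-1 - q] this is the derivative, with respect to the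
   spacing [q], of the interaction energy of [N] particles; smaller [A] and [B]
   keep only the pairs close to [q]. *)
Definition window x q A B : R :=
  \sum_(a < A) \sum_(b < B | in_range m (a + b).+1)
    w1 (x (q + b).+1 - x (q - a)%N).

Definition spacing (x : nat -> R) l := x l.+1 - x l.

Lemma dist_diff x y i i' k M :
  (forall l, (l < k)%N -> `|spacing x (i + l)%N - spacing y (i' + l)%N| <= M) ->
  `|(x (i + k)%N - x i) - (y (i' + k)%N - y i')| <= k%:R * M.
Proof.
elim: k => [|k IH] H; first by rewrite !addn0 !subrr normr0 mul0r.
rewrite -natr1 mulrDl mul1r !addnS.
have -> : x (i + k).+1 - x i - (y (i' + k).+1 - y i')
   = (x (i + k)%N - x i - (y (i' + k)%N - y i'))
     + (spacing x (i + k)%N - spacing y (i' + k)%N).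
  by rewrite /spacing; ring.
apply: le_trans (ler_normD _ _) _; apply: lerD; last exact: H.
by apply: IH => l lk; apply: H; lia.
Qed.

Lemma box_dist x i k : box zmin zmax x ->
  k%:R * zmin <= x (i + k)%N - x i <= k%:R * zmax.
Proof.
move=> bx; apply/andP; split; [apply: dist_ge|apply: dist_le] => l _;
  by have /andP[] := bx l.
Qed.

Lemma w1_expand_norm a b : zmin <= a <= zmax -> zmin <= b <= zmax ->
  w2 zmax * `|a - b| <= `|w1 a - w1 b|.
Proof.
have K0 : 0 <= w2 zmax.
  have := cp_Q hw 0; rewrite big_geq// => Q0; have := cp_QK hw; lra.
wlog ab : a b / a <= b => [th|/andP[za _] /andP[_ bz]].
  by case/orP: (le_total a b) => ab ? ?; [|rewrite distrC (distrC (w1 a))]; exact: th.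
have H := w1_expand hw za ab bz.
rewrite distrC ger0_norm ?subr_ge0// distrC ger0_norm//.
by apply: le_trans H; rewrite mulr_ge0// subr_ge0.
Qed.

(** The term [a = b = 0] of the window is [w1] of the spacing itself and separates the two chains by
    [w2 zmax] times the difference. A pair at index distance [k >= 2] has distances differing by at
    most [k * M], hence contributes at most [- w2 (k * zmin) * k * M]; there are at most [k] such
    pairs, which gives [Q * M] in all. *)
Lemma spacing_contraction x y q q' A B M :
  box zmin zmax x -> box zmin zmax y ->
  (0 < A)%N -> (0 < B)%N -> (A <= q.+1)%N -> (A <= q'.+1)%N ->
  (forall a, (a < A)%N -> `|spacing x (q - a)%N - spacing y (q' - a)%N| <= M) ->
  (forall b, (b < B)%N -> `|spacing x (q + b)%N - spacing y (q' + b)%N| <= M) ->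
  w2 zmax * `|spacing x q - spacing y q'|
    <= `|window x q A B - window y q' A B| + Q * M.
Proof.
move=> bx by_ A0 B0 Aq Aq' HA HB.
have M0 : 0 <= M by apply: le_trans (HB 0%N B0); exact: normr_ge0.
pose F a b : R := if in_range m (a + b).+1 then
  w1 (x (q + b).+1 - x (q - a)%N) - w1 (y (q' + b).+1 - y (q' - a)%N) else 0.
(* [g] vanishes at [k = 1], so the double sum of [g] leaves out the pair [a = b = 0]. *)
pose g k : R := if (2 <= k)%N then - w2 (k%:R * zmin) * (k%:R * M) else 0.
have g0 k : 0 <= g k.
  rewrite /g; case: ifP => // k2; rewrite mulr_ge0 ?mulr_ge0// oppr_ge0.
  exact/(cp_w2np hw)/(muln_2zmin hw).
have WE : window x q A B - window y q' A B = \sum_(a < A) \sum_(b < B) F a b.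
  rewrite /window -sumrB; apply: eq_bigr => a _.
  rewrite big_mkcond [X in _ - X]big_mkcond -sumrB; apply: eq_bigr => b _.
  by rewrite /F; case: in_range; rewrite ?subr0.
have Fg a b : (a < A)%N -> (b < B)%N -> (0 < a + b)%N -> `|F a b| <= g (a + b).+1.
  move=> aA bB ab; rewrite /F; case: in_range; last by rewrite normr0.
  have /andP[dx _] := box_dist (q - a) (a + b).+1 bx.
  have /andP[dy _] := box_dist (q' - a) (a + b).+1 by_.
  have := @dist_diff x y (q - a) (q' - a) (a + b).+1 M.
  have Ex : (q - a + (a + b).+1)%N = (q + b).+1 by lia.
  have Ey : (q' - a + (a + b).+1)%N = (q' + b).+1 by lia.
  move: dx dy; rewrite Ex Ey => dx dy /(_ _) D.
  rewrite /g ltnS ab; apply: le_trans (w1_lipschitz hw _ dx dy) _ => //.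
  apply: ler_wpM2l.
    by rewrite oppr_ge0; apply/(cp_w2np hw)/(muln_2zmin hw).
  (* The spacings between [q - a] and [q + b] are split at [q], to the left for [HA] and to the
     right for [HB]. *)
  apply: D => l lab; have [la|al] := leqP a l.
    have := HB (l - a)%N.
    have -> : (q - a + l = q + (l - a))%N by lia.
    have -> : (q' - a + l = q' + (l - a))%N by lia.
    by apply; lia.
  have := HA (a - l)%N.
  have -> : (q - a + l = q - (a - l))%N by lia.
  have -> : (q' - a + l = q' - (a - l))%N by lia.
  by apply; lia.
have F00 : w2 zmax * `|spacing x q - spacing y q'| <= `|F 0%N 0%N|.
  rewrite /F (in_range1 hm) !addn0 !subn0.
  exact: w1_expand_norm (bx q) (by_ q').
have sumg : \sum_(a < A) \sum_(b < B) g (a + b).+1 <= Q * M.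
  apply: le_trans (sum_pairs_le _ _ g0) _.
  have -> : \sum_(0 <= k < A + B) k%:R * g k = \sum_(2 <= k < A + B) k%:R * g k.
    rewrite big_ltn; last by lia.
    rewrite big_ltn; last by lia.
    by rewrite /g !mulr0 !add0r.
  apply: le_trans (ler_wpM2r M0 (cp_Q hw (A + B))).
  rewrite mulr_suml; apply: ler_sum_nat => k /andP[k2 _].
  by rewrite /g k2 le_eqVlt; apply/orP; left; apply/eqP; ring.
have step : `|F 0%N 0%N| <= `|\sum_(a < A) \sum_(b < B) F a b|
    + \sum_(a < A) \sum_(b < B) g (a + b).+1.
  case: A A0 {Aq Aq' HA WE sumg} Fg => // A _; case: B B0 {HB} => // B _ Fg.
  rewrite big_ord_recl [in leRHS]big_ord_recl /=.
  set S1 := \sum_(b < B) F _ _; set S2 := \sum_(i < A) _.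
  rewrite [X in _ + X]big_ord_recl /= [X in _ + (X + _)]big_ord_recl /=.
  have S1g : `|S1| <= \sum_(b < B) g (0 + bump 0 b).+1.
    apply: le_trans (ler_norm_sum _ _ _) _; apply: ler_sum => b _.
    by apply: Fg => //; rewrite /bump /= ltnS.
  have S2g : `|S2| <= \sum_(a < A) \sum_(b < B.+1) g (bump 0 a + b).+1.
    apply: le_trans (ler_norm_sum _ _ _) _; apply: ler_sum => a _.
    apply: le_trans (ler_norm_sum _ _ _) _; apply: ler_sum => b _.
    by apply: Fg => //; rewrite /bump /= ltnS.
  have tri (u s t : R) : `|u| <= `|u + s + t| + `|s| + `|t|.
    have := ler_normB (u + s + t - s) t; have := ler_normB (u + s + t) s.
    rewrite (_ : u + s + t - s - t = u); [lra|ring].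
  have g1 : g 1%N = 0 by [].
  apply: le_trans (tri _ S1 S2) _.
  by rewrite -!addrA lerD2l g1 add0r lerD.
rewrite WE; lra.
Qed.

End contraction.

(** * Uniqueness of critical chains and convergence of bulk spacings *)

Section bulk_spacing.
Context {R : realType}.
Variables (w w1 w2 : R -> R) (rhc zmin zmax Q : R).
Variables (tau : nat -> R -> R) (lam : nat -> R).
Hypothesis hw : chain_potential w w1 w2 rhc zmin zmax Q tau lam.
Variables (m : option nat) (p : R).
Hypothesis hm : m <> Some 0%N.

Lemma summable_tail (f : nat -> R) : (forall k, 0 <= f k) ->
  (exists C, forall n, \sum_(0 <= k < n) f k <= C) ->
  forall e, 0 < e -> exists K, forall n, \sum_(K <= k < n) f k <= e.
Proof.
move=> f0 [C HC] e e0.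
pose S := [set \sum_(0 <= k < n) f k | n in [set: nat]].
have supS : has_sup S.
  by split; [exists (\sum_(0 <= k < 0) f k), 0%N|exists C => _ [n _ <-]].
have [_ [K _ <-] HK] := sup_adherent e0 supS.
exists K => n; have [Kn|nK] := leqP K n; last by rewrite big_geq ?(ltW e0)// ltnW.
have : \sum_(0 <= k < n) f k <= sup S by apply: ub_le_sup; [case: supS|exists n].
by rewrite (big_cat_nat (n := K))//=; lra.
Qed.

(** The weight [k] counts the pairs at index distance [k] across a spacing; by [w1_lam] the weighted
    terms are dominated by the summable [lam], and the bound [4] is where that estimate starts. *)
Lemma w1_tail e : 0 < e ->
  exists2 K, (4 <= K)%N & forall n, \sum_(K <= k < n) k%:R * w1 (k%:R * zmin) <= e.
Proof.
move=> e0; have z0 := zmin_gt0 hw.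
have e0' : 0 < e * (zmin / 2) by rewrite mulr_gt0// divr_gt0.
have [K HK] := summable_tail (cp_lam0 hw) (cp_lamS hw) e0'.
exists (maxn K 4); first exact: leq_maxr.
move=> n; apply: (@le_trans _ _ (\sum_(maxn K 4 <= k < n) 2 / zmin * lam k)).
  apply: ler_sum_nat => k /andP[Kk _]; apply: (w1_lam hw).
  by move: Kk; rewrite geq_max => /andP[].
rewrite -mulr_sumr mulrAC ler_pdivrMr//.
have [nK|Kn] := leqP n (maxn K 4); first by rewrite big_geq// mulr0 mulr_ge0// ltW.
have := HK n; rewrite (big_cat_nat (n := maxn K 4)) //=; [|exact: leq_maxl|exact: ltnW].
have : 0 <= \sum_(K <= i < maxn K 4) lam i by apply: sumr_ge0 => *; exact: (cp_lam0 hw).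
lra.
Qed.

(** The Euler-Lagrange equations, one per spacing: the full window has [q.+1] particles on the left
    of the spacing [q] and [N.-1 - q] on its right. *)
Definition critical N x :=
  box zmin zmax x /\
  forall q, (q.+1 < N)%N -> p + window w1 m x q q.+1 (N.-1 - q) = 0.

(** The pairs cut off have index distance [k > K], where [w1] is nonnegative and decreasing, so each
    contributes between zero and [w1 (k * zmin)]. *)
Lemma window_truncate x q A B K : box zmin zmax x ->
  (2 <= K)%N -> (K <= A)%N -> (K <= B)%N -> (A <= q.+1)%N ->
  0 <= window w1 m x q A B - window w1 m x q K K
    <= \sum_(K <= k < A + B) k%:R * w1 (k%:R * zmin).
Proof.
move=> bx K0 KA KB Aq.
pose F a b : R := if in_range m (a + b).+1
                  then w1 (x (q + b).+1 - x (q - a)%N) else 0.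
have WE A' B' : window w1 m x q A' B' = \sum_(a < A') \sum_(b < B') F a b.
  by apply: eq_bigr => a _; rewrite big_mkcond.
have WK : window w1 m x q K K =
    \sum_(a < A) \sum_(b < B) if (a < K)%N && (b < K)%N then F a b else 0.
  rewrite WE (big_ord_widen _ (fun a => \sum_(b < K) F a b) KA) big_mkcond.
  apply: eq_bigr => a _; case: ifP => aK; last by rewrite big1.
  by rewrite (big_ord_widen _ (F a) KB) big_mkcond.
have -> : window w1 m x q A B - window w1 m x q K K =
    \sum_(a < A) \sum_(b < B) if (a < K)%N && (b < K)%N then 0 else F a b.
  rewrite WK WE -sumrB; apply: eq_bigr => a _; rewrite -sumrB.
  by apply: eq_bigr => b _; case: ifP; rewrite ?subrr ?subr0.
pose g k : R := if (K < k)%N then w1 (k%:R * zmin) else 0.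
have g0 k : 0 <= g k.
  rewrite /g; case: ifP => // Kk; apply/(w1_ge0 hw)/(muln_2zmin hw); lia.
have Fg a b : (a < A)%N -> (K < (a + b).+1)%N -> 0 <= F a b <= g (a + b).+1.
  move=> aA Kab; rewrite /F; case: in_range; last by rewrite lexx g0.
  have /andP[dx _] := box_dist (q - a) (a + b).+1 bx.
  have Ex : (q - a + (a + b).+1)%N = (q + b).+1 by lia.
  rewrite Ex in dx.
  have kz : 2 * zmin <= (a + b).+1%:R * zmin by apply: (muln_2zmin hw); lia.
  by rewrite /g Kab (w1_ge0 hw) ?(w1_dec hw)// (le_trans kz).
apply/andP; split.
  apply: sumr_ge0 => a _; apply: sumr_ge0 => b _; case: ifPn => // H.
  by have /andP[] := Fg a b (ltn_ord a) ltac:(lia).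
apply: (@le_trans _ _ (\sum_(a < A) \sum_(b < B) g (a + b).+1)).
  apply: ler_sum => a _; apply: ler_sum => b _; case: ifPn => // H.
  by have /andP[] := Fg a b (ltn_ord a) ltac:(lia).
apply: le_trans (sum_pairs_le _ _ g0) _.
rewrite (big_cat_nat (n := K)) //=; last by lia.
rewrite big_nat big1 ?add0r; last first.
  by move=> k ?; rewrite /g ltnNge (_ : (k <= K)%N) ?mulr0//; lia.
apply: ler_sum_nat => k /andP[Kk _]; apply: ler_wpM2l => //.
rewrite /g; case: ifP => // _; apply/(w1_ge0 hw)/(muln_2zmin hw).
exact: leq_trans Kk.
Qed.

Lemma Q_ge0 : 0 <= Q.
Proof. by have := cp_Q hw 0; rewrite big_geq. Qed.

(** Maximum principle: at a spacing where the difference [M] is largest, both equations have the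
    same full window, so the windows agree and [w2 zmax * M <= Q * M], which forces [M = 0]. *)
Lemma critical_unique N x y : critical N x -> critical N y ->
  forall q, (q.+1 < N)%N -> spacing x q = spacing y q.
Proof.
move=> [bx cx] [by_ cy].
case: N cx cy => [|[|N]]// cx cy q0 q0N.
pose q := [arg max_(q > ord0 : 'I_N.+1) `|spacing x q - spacing y q|]%O.
have qmax (l : nat) : (l < N.+1)%N ->
   `|spacing x l - spacing y l| <= `|spacing x q - spacing y q|.
  move=> lN; rewrite /q; case: arg_maxP => //= i _.
  by move=> /(_ (Ordinal lN) isT).
have qN := ltn_ord q.
set M := `|spacing x q - spacing y q| in qmax *.
have B0 : (0 < N.+1 - q)%N by rewrite subn_gt0.
have H : w2 zmax * M <= `|window w1 m x q q.+1 (N.+1 - q) -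
    window w1 m y q q.+1 (N.+1 - q)| + Q * M.
  apply: (spacing_contraction hw hm) => // [a aq|b bN]; apply: qmax; lia.
have wx := cx q qN; have wy := cy q qN.
have wxy : window w1 m x q q.+1 (N.+1 - q) - window w1 m y q q.+1 (N.+1 - q) = 0.
  by move: wx wy => /=; lra.
rewrite wxy normr0 add0r -subr_le0 -mulrBl in H.
have K0 := cp_QK hw.
rewrite pmulr_rle0 ?subr_gt0// in H.
apply/eqP; rewrite -subr_eq0 -normr_le0.
exact: le_trans (qmax _ q0N) H.
Qed.

(** The chains may have different lengths and the spacings different places; only the depth [K] from
    the ends matters, and it is uniform in the chains. *)
Definition bulk_bound M := exists K, forall N N' x y q q',
  critical N x -> critical N' y ->
  (K <= q)%N -> (q + K.+1 < N)%N -> (K <= q')%N -> (q' + K.+1 < N')%N ->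
  `|spacing x q - spacing y q'| <= M.

(** Half of the gap [w2 zmax - Q], times [M], is granted to the truncation of the windows. The
    contraction estimate then has right-hand side [(w2 zmax - Q) / 2 * M + Q * M], and division by
    [w2 zmax] gives the new factor. *)
Lemma bulk_bound_step M : 0 < M -> bulk_bound M ->
  bulk_bound ((w2 zmax + Q) / (2 * w2 zmax) * M).
Proof.
move=> M0 [K HK].
have QK := cp_QK hw; have Q0 := Q_ge0; have k0 : 0 < w2 zmax by lra.
have e0 : 0 < (w2 zmax - Q) / 2 * M by rewrite mulr_gt0// divr_gt0// subr_gt0.
have [L L4 HL] := w1_tail e0.
have idx (n i l : nat) : (K + L <= i)%N -> (i + (K + L).+1 < n)%N ->
    (l < L)%N -> [/\ (K <= i - l)%N, (i - l + K.+1 < n)%N,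
      (K <= i + l)%N, (i + l + K.+1 < n)%N & (L <= i.+1)%N].
  by clear; move=> *; split; lia.
(* At depth [K + L] all spacings within [L] of [q] still have depth [K], so the bound [M] applies to
   them. *)
exists (K + L)%N => N N' x y q q' cx cy Kq qN Kq' qN'.
(* The truncation error is one-sided, so both truncated windows lie in the same interval of length
   [(w2 zmax - Q) / 2 * M] below [- p]. *)
have near0 N1 z q1 : critical N1 z -> (K + L <= q1)%N -> (q1 + (K + L).+1 < N1)%N ->
    0 <= - p - window w1 m z q1 L L <= (w2 zmax - Q) / 2 * M.
  move=> [bz cz] q1K q1N; have := cz q1 ltac:(lia).
  have := @window_truncate z q1 q1.+1 (N1.-1 - q1) L bz
    ltac:(lia) ltac:(lia) ltac:(lia) ltac:(lia).
  have := HL (q1.+1 + (N1.-1 - q1))%N.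
  move=> H1 /andP[H2 H3] H4; apply/andP; split; lra.
have /andP[x1 x2] := near0 _ _ _ cx Kq qN.
have /andP[y1 y2] := near0 _ _ _ cy Kq' qN'.
have H : w2 zmax * `|spacing x q - spacing y q'| <= `|window w1 m x q L L -
    window w1 m y q' L L| + Q * M.
  have L0 : (0 < L)%N by exact: leq_trans L4.
  have [_ _ _ _ Lq] := idx _ _ _ Kq qN L0; have [_ _ _ _ Lq'] := idx _ _ _ Kq' qN' L0.
  apply: (spacing_contraction hw hm) => //; [by case: cx|by case: cy| |].
    move=> a aL; have [? ? _ _ _] := idx _ _ _ Kq qN aL.
    by have [? ? _ _ _] := idx _ _ _ Kq' qN' aL; exact: (HK N N').
  move=> b bL; have [_ _ ? ? _] := idx _ _ _ Kq qN bL.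
  by have [_ _ ? ? _] := idx _ _ _ Kq' qN' bL; exact: (HK N N').
have W : `|window w1 m x q L L - window w1 m y q' L L| <= (w2 zmax - Q) / 2 * M.
  by rewrite ler_norml; apply/andP; split; lra.
rewrite mulrAC ler_pdivlMr; last by rewrite mulr_gt0.
lra.
Qed.

(** The width [zmax - zmin] of the box is a bound at depth zero; iterating [bulk_bound_step]
    multiplies it by powers of [t < 1]. *)
Lemma bulk_cauchy e : 0 < e -> bulk_bound e.
Proof.
move=> e0; pose D := zmax - zmin; pose t := (w2 zmax + Q) / (2 * w2 zmax).
have QK := cp_QK hw; have Q0 := Q_ge0; have k0 : 0 < w2 zmax by lra.
have D0 : 0 < D by rewrite subr_gt0 (cp_zz hw).
have t0 : 0 < t by rewrite divr_gt0// ?mulr_gt0//; lra.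
have t1 : t < 1 by rewrite ltr_pdivrMr ?mulr_gt0//; lra.
have Hn n : bulk_bound (D * t ^+ n).
  elim: n => [|n IH]; last first.
    by rewrite exprS mulrCA; apply: bulk_bound_step => //; rewrite mulr_gt0// exprn_gt0.
  exists 0%N => N N' x y q q' [bx _] [by_ _] _ _ _ _; rewrite expr0 mulr1.
  have /andP[? ?] := bx q; have /andP[? ?] := by_ q'.
  by rewrite ler_norml /D /spacing; apply/andP; split; lra.
have /cvgrPdist_lt /(_ _ e0) [n _ /(_ n (leqnn n))] : geometric D t @ \oo --> (0 : R).
  by apply: cvg_geometric; rewrite gtr0_norm.
rewrite /= sub0r normrN ger0_norm; last first.
  by rewrite mulr_ge0 ?exprn_ge0// ltW.
move=> Dn; have [K HK] := Hn n; exists K => N N' x y q q' *.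
by apply: le_trans (ltW Dn); apply: (HK N N').
Qed.

Lemma bulk_limit (X : nat -> nat -> R) : (forall N, (2 <= N)%N -> critical N (X N)) ->
  exists2 a, zmin <= a <= zmax & forall e, 0 < e ->
    exists K, forall N x q, critical N x -> (K <= q)%N -> (q + K.+1 < N)%N ->
      `|spacing x q - a| <= e.
Proof.
(* A chain of [2 * n + 2] particles has [2 * n + 1] spacings, of which [n] is the middle one; its
   depth grows with [n]. *)
move=> XP; pose u n := spacing (X n.*2.+2) n.
have XP' n : critical n.*2.+2 (X n.*2.+2) by exact: XP.
have cu : cvgn u.
  apply/cauchy_cvgP/cauchy_exP => e e0.
  have e20 : 0 < e / 2 by rewrite divr_gt0.
  have [K HK] := bulk_cauchy e20.
  exists (u K), K => // n /= Kn; rewrite /ball /=.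
  apply: (@le_lt_trans _ _ (e / 2)); last by rewrite ltr_pdivrMr// ltr_pMr// ltr1n.
  apply: (HK K.*2.+2 n.*2.+2) => //; move: Kn; clear; lia.
exists (limn u).
  apply/andP; split.
    apply: limr_ge => //; apply: nearW => n.
    by have [/(_ n)/andP[]] := XP' n.
  apply: limr_le => //; apply: nearW => n.
  by have [/(_ n)/andP[]] := XP' n.
move=> e e0; have [K HK] := bulk_cauchy e0; exists K => N x q cx Kq qN.
have cl : `|spacing x q - u n| @[n --> \oo] --> `|spacing x q - limn u|.
  by apply: cvg_norm; apply: cvgB => //; exact: cvg_cst.
rewrite -(cvg_lim _ cl)//; apply: limr_le; first by apply/cvg_ex; eexists; exact: cl.
exists K => // n /= Kn; by apply: (HK N n.*2.+2) => //; move: Kn; clear; lia.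
Qed.

End bulk_spacing.

(** * Euler-Lagrange equations and existence of minimizers *)

Section criticality.
Context {R : realType}.
Variables (w w1 w2 : R -> R) (rhc zmin zmax Q : R).
Variables (tau : nat -> R -> R) (lam : nat -> R).
Hypothesis hw : chain_potential w w1 w2 rhc zmin zmax Q tau lam.
Variables (m : option nat) (p : R).
Local Notation E := (chain_energy w m p).

Lemma continuous_sum (T : topologicalType) (I : Type) (r : seq I) (P : pred I)
    (f : I -> T -> R) (t : T) :
  (forall i, P i -> {for t, continuous (f i)}) ->
  {for t, continuous (fun y => \sum_(i <- r | P i) f i y)}.
Proof.
move=> fc; elim: r => [|i r IH].
  rewrite (_ : (fun y => _) = cst 0); first exact: cvg_cst.
  by apply/funext => y; rewrite big_nil.
rewrite (_ : (fun y => _) = if P i then f i \+ (fun y => \sum_(i <- r | P i) f i y)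
   else (fun y => \sum_(i <- r | P i) f i y)); last first.
  by apply/funext => y; rewrite big_cons; case: ifP.
case: ifP => // Pi; apply: continuousD => //; exact: fc.
Qed.

(* A chain of [n] spacings is continued to infinity with spacings [zmax]. *)
Definition spacing_of n (z : 'rV[R]_n) (l : nat) : R :=
  oapp (fun k => z ord0 k) zmax (insub l).

Definition position_of n (z : 'rV[R]_n) (j : nat) : R := \sum_(l < j) spacing_of z l.

Lemma spacing_of_ord n (z : 'rV[R]_n) (k : 'I_n) : spacing_of z k = z ord0 k.
Proof. by rewrite /spacing_of valK. Qed.

Lemma spacing_position n (z : 'rV[R]_n) l :
  position_of z l.+1 - position_of z l = spacing_of z l.
Proof. by rewrite /position_of big_ord_recr /= addrAC subrr add0r. Qed.

Lemma spacing_of_prop n (z : 'rV[R]_n) (P : R -> Prop) :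
  P zmax -> (forall k, P (z ord0 k)) -> forall l, P (spacing_of z l).
Proof. by move=> Pz Pk l; rewrite /spacing_of; case: insubP => /=. Qed.

Lemma continuous_position n j : continuous (@position_of n ^~ j).
Proof.
move=> z; apply: continuous_sum => l _; rewrite /spacing_of.
case: insubP => [k _ _|_] /=; first exact: coord_continuous.
exact: cst_continuous.
Qed.

Lemma box_position n (z : 'rV[R]_n) :
  (forall k, zmin <= z ord0 k <= zmax) -> box zmin zmax (position_of z).
Proof.
move=> zb l; rewrite spacing_position.
by apply: (spacing_of_prop (P := fun r => zmin <= r <= zmax)) => //; rewrite lexx ltW ?(cp_zz hw).
Qed.

Lemma box_gt_rhc x : box zmin zmax x -> forall l, rhc < x l.+1 - x l.
Proof. by move=> bx l; have /andP[+ _] := bx l; apply: lt_le_trans (cp_rz hw). Qed.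

Lemma position_of_row n x :
  forall l, (l < n)%N -> spacing (position_of (\row_(k < n) spacing x k)) l = spacing x l.
Proof.
move=> l ln; rewrite /spacing spacing_position (spacing_of_ord _ (Ordinal ln)).
by rewrite mxE.
Qed.

Lemma energy_continuous n (z : 'rV[R]_n) : (forall k, zmin <= z ord0 k <= zmax) ->
  {for z, continuous (fun z => E n.+1 (position_of z))}.
Proof.
move=> zb; have bx := box_position zb.
apply: (@continuousD _ _ _ (fun z : 'rV[R]_n =>
  \sum_(i < n.+1) \sum_(j < n.+1 | (i < j)%N && in_range m (j - i))
     w (position_of z j - position_of z i))
  (fun z : 'rV[R]_n => p * (position_of z n.+1.-1 - position_of z 0%N))).
  apply: continuous_sum => i _; apply: continuous_sum => j /andP[ij _].
  apply: (@continuous_comp _ _ _ (fun z => position_of z j - position_of z i) w).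
    by apply: continuousB; exact: continuous_position.
  apply: (cp_continuous hw).
  have /andP[+ _] := box_dist i (j - i) bx.
  rewrite subnKC 1?ltnW//; apply: lt_le_trans; apply: (rhc_lt_muln hw) => //.
  by rewrite subn_gt0.
apply: continuousM; first exact: cst_continuous.
by apply: continuousB; exact: continuous_position.
Qed.

(** Moving all particles after [q] by [t] changes the spacing [q] alone. For [t] of size less than
    [zmin - rhc] all distances stay above [rhc], so the energy is differentiable in [t], with a
    minimum at zero. *)
Lemma minimizer_critical N x : box zmin zmax x ->
  (forall y, (forall l, rhc < y l.+1 - y l) -> E N x <= E N y) ->
  critical w1 zmin zmax m p N x.
Proof.
move=> bx xmin; split => // q qN.
have rz := cp_rz hw; have zz := cp_zz hw.
pose in_ i j : bool := (i <= q < j)%N.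
pose sh t (j : nat) := x j + t *+ (q < j)%N.
have shE t i j : (i < j)%N -> sh t j - sh t i = x j - x i + t *+ in_ i j.
  move=> ij; rewrite /sh /in_.
  case: (ltnP q j) => qj; case: (ltnP q i) => qi /=; rewrite ?mulr1n ?mulr0n; try lra.
  by have := leq_trans qi (ltnW (leq_trans ij qj)); rewrite ltnn.
have shr t : t \in `](- (zmin - rhc)), (zmin - rhc)[ ->
    forall i j, (i < j)%N -> rhc < sh t j - sh t i.
  rewrite in_itv /= => /andP[t1 t2] i j ij; rewrite shE//.
  have /andP[+ _] := box_dist i (j - i) bx; rewrite subnKC 1?ltnW//.
  have : zmin <= (j - i)%:R * zmin.
    by rewrite ler_peMl ?ler1n ?subn_gt0// ltW// (zmin_gt0 hw).
  by case: (in_ i j); rewrite ?mulr1n ?mulr0n; lra.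
pose h (i j : nat) : R -> R := fun t =>
  if (i < j)%N && in_range m (j - i) then w (x j - x i + t *+ in_ i j) else 0.
pose g : R -> R := \sum_(i < N) \sum_(j < N) (h i j) + (fun t => p * (x N.-1 - x 0%N + t)).
pose dh (i j : nat) : R -> R := fun t =>
  if (i < j)%N && in_range m (j - i) then w1 (x j - x i + t *+ in_ i j) *+ in_ i j else 0.
pose dg t : R := \sum_(i < N) \sum_(j < N) dh i j t + p.
have gE t : g t = E N (sh t).
  rewrite /g /chain_energy /= [LHS]/(_ + _) fct_sumE; congr (_ + _).
    apply: eq_bigr => i _; rewrite fct_sumE [RHS]big_mkcond; apply: eq_bigr => j _.
    by rewrite /h; case: ifP => // /andP[ij _]; rewrite shE.
  have N0 : (0 < N.-1)%N by lia.
  by rewrite shE// /in_ (_ : (q < N.-1)%N)//; lia.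
have gd t : t \in `](- (zmin - rhc)), (zmin - rhc)[ -> is_derive t 1 g (dg t).
  move=> tI; rewrite /g /dg.
  apply: is_deriveD.
    apply: is_derive_sum => i; apply: is_derive_sum => j.
    rewrite /h /dh; case: ifP => [/andP[ij _]|_]; last exact: is_derive_cst.
    have := shr t tI i j ij; rewrite shE//; case: (in_ i j); rewrite ?mulr1n ?mulr0n => rr.
      have d1 := cp_d1 hw rr.
      have d2 : is_derive t (1 : R) (fun y => x j - x i + y) 1.
        by apply: is_derive_eq; rewrite !(subr0, add0r, mulr1).
      have := @is_derive1_comp _ w (fun y => x j - x i + y) t _ _ d1 d2.
      by rewrite mulr1.
    rewrite (_ : (fun _ => _) = cst (w (x j - x i + 0))); first exact: is_derive_cst.
    by apply/funext => y; rewrite mulr0n.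
  by apply: is_derive_eq; rewrite !(add0r, scaler1, mulr1).
have I0 : (0 : R) \in `](- (zmin - rhc)), (zmin - rhc)[ by rewrite in_itv /=; apply/andP; split; lra.
have g0 : is_derive (0 : R) 1 g 0.
  apply: (@derive1_at_min _ g (- (zmin - rhc)) (zmin - rhc)) => //; first lra.
    by move=> t /gd gt; exact: ex_derive.
  move=> t tI; rewrite !gE; have -> : sh 0 = x.
    by apply/funext => j; rewrite /sh mul0rn addr0.
  by apply: xmin => l; exact: shr.
have dg0 : dg 0 = 0.
  by rewrite -(@derive_val _ _ _ _ _ _ _ (gd 0 I0)) (@derive_val _ _ _ _ _ _ _ g0).
rewrite -dg0 /dg addrC; congr (_ + _).
have qN' : (q.+1 <= N)%N by lia.
rewrite /window.
(* Only pairs with [i <= q < j] depend on [t]; the window lists them by [a = q - i] and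
   [b = j - q - 1]. *)
rewrite (reindex_inj rev_ord_inj) /=.
rewrite (big_ord_widen _ (fun a => \sum_(b < N.-1 - q | in_range m (q.+1 - a.+1 + b).+1)
    w1 (x (q + b).+1 - x (q - (q.+1 - a.+1))%N)) qN') big_mkcond.
apply: eq_bigr => i _; case: ifPn => iq; last first.
  by rewrite big1// => j _; rewrite /dh /in_ (_ : (i <= q)%N = false) ?if_same//; lia.
rewrite -(big_mkord xpredT (fun j => dh i j 0)) (big_cat_nat (n := q.+1)) //=.
rewrite [X in X + _]big_nat [X in X + _]big1 ?add0r; last first.
  by move=> j ?; rewrite /dh /in_ (_ : (q < j)%N = false) ?andbF ?if_same//; lia.
rewrite -[X in index_iota X _](add0n q.+1) big_addn big_mkord.
rewrite (_ : (N - q.+1 = N.-1 - q)%N); last by lia.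
rewrite [LHS]big_mkcond; apply: eq_bigr => b _; rewrite /dh /in_.
rewrite mul0rn addr0.
have -> : (i < b + q.+1)%N by lia.
have -> : (i <= q < b + q.+1)%N by lia.
rewrite (_ : (q.+1 - i.+1 + b).+1 = (b + q.+1 - i)%N); last by lia.
rewrite (_ : (q - (q.+1 - i.+1))%N = i :> nat); last by lia.
by rewrite addnS addnC.
Qed.

End criticality.

Section existence.
Context {R : realType}.
Variables (w w1 w2 : R -> R) (rhc zmin zmax Q : R).
Variables (tau : nat -> R -> R) (lam : nat -> R).
Hypothesis hw : chain_potential w w1 w2 rhc zmin zmax Q tau lam.
Variables (m : option nat) (p : R).
Hypotheses (hm : m <> Some 0%N) (p0 : 0 <= p) (pneg : p * zmax + w zmax < 0).
Local Notation E := (chain_energy w m p).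

(** The energy is continuous on the compact box and attains its minimum there; [energy_box_le]
    extends the comparison to all chains with spacings above [rhc]. *)
Lemma energy_minimizer_exists n : exists2 z : 'rV[R]_n,
  forall k, zmin <= z ord0 k <= zmax &
  forall y, (forall l, rhc < y l.+1 - y l) -> E n.+1 (position_of zmax z) <= E n.+1 y.
Proof.
pose A : set 'rV[R]_n := [set z | forall k, `[zmin, zmax]%classic (z ord0 k)].
have AP z : A z <-> forall k, zmin <= z ord0 k <= zmax.
  by rewrite /A /=; split => H k; have := H k; rewrite /= in_itv.
have A0 : A !=set0.
  exists (const_mx zmin); apply/AP => k; rewrite mxE lexx/=; exact/ltW/(cp_zz hw).
have Ac : compact A.
  apply: (@rV_compact _ n (fun=> `[zmin, zmax]%classic)) => _.
  exact: segment_compact.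
have Ec : {within A, continuous (fun z : 'rV[R]_n => E n.+1 (position_of zmax z))}.
  apply: continuous_in_subspaceT => z zA; apply: (energy_continuous hw); apply/AP.
  by rewrite inE in zA.
have [z zA zmn] := EVT_min_rV A0 Ac Ec.
exists z; first by apply/AP; rewrite inE in zA.
move=> y ry; have [u [bu uy _]] := energy_box_le hw hm p0 pneg n.+1 ry.
apply: le_trans uy.
rewrite -(@chain_energy_eq _ w m p n.+1 (position_of zmax (\row_(k < n) spacing u k)) u); last first.
  by move=> l ln; have := @position_of_row _ zmax n u l ln; rewrite /spacing.
by apply: zmn; rewrite inE; apply/AP => k; rewrite mxE; exact: bu.
Qed.

End existence.

(** * Energy density *)

Section density.
Context {R : realType}.
Variables (w w1 w2 : R -> R) (rhc zmin zmax Q : R).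
Variables (tau : nat -> R -> R) (lam : nat -> R).
Hypothesis hw : chain_potential w w1 w2 rhc zmin zmax Q tau lam.
Variables (m : option nat) (p : R).
Hypothesis p0 : 0 <= p.
Local Notation E := (chain_energy w m p).

Definition partial_bulk (r : R) n : R :=
  \sum_(1 <= k < n | in_range m k) w (k%:R * r).

(** One formula for all ranges: for finite [m] the partial sums are eventually constant. *)
Definition bulk (r : R) : R := p * r + limn (partial_bulk r).

(** Each pair is charged to its left particle. *)
Definition row_energy x i n : R :=
  \sum_(1 <= k < n | in_range m k) w (x (i + k)%N - x i).

(** The added term belongs to the spacing after the last particle, so that each of the [N.+1]
    particles carries one spacing. *)
Lemma chain_energy_rows N x : E N.+1 x + p * spacing x N =
  \sum_(i < N.+1) (row_energy x i (N.+1 - i) + p * spacing x i).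
Proof.
rewrite big_split /= /chain_energy -addrA; congr (_ + _); last first.
  rewrite -mulr_sumr -mulrDr; congr (p * _); rewrite /spacing /=.
  elim: N => [|N IH]; first by rewrite big_ord1 addrC subrr addr0.
  by rewrite big_ord_recr /= -IH; ring.
apply: eq_bigr => i _; rewrite /row_energy.
rewrite -(big_mkord (fun j => (i < j)%N && in_range m (j - i)) (fun j => w (x j - x i))).
have iN := ltn_ord i.
rewrite (big_cat_nat (n := i.+1)) //= big_nat_cond big1 ?add0r; last first.
  by move=> j /and3P[]; rewrite ltnS => /andP[_ ji]; rewrite ltnNge ji.
rewrite -[X in index_iota X _]add1n big_addn big_nat_cond [RHS]big_nat_cond.
apply: eq_big => [k|k _]; last by rewrite addnC.
by case: k => //= k; rewrite addnK addSn ltnS leq_addl.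
Qed.

Lemma dist_const (r : R) i k : (i + k)%:R * r - i%:R * r = k%:R * r.
Proof. by rewrite natrD; ring. Qed.

Lemma box_const r : zmin <= r <= zmax -> box zmin zmax (fun n => n%:R * r).
Proof. by move=> rb l; rewrite -natr1 mulrDl mul1r addrAC subrr add0r. Qed.

Lemma row_const r i n : row_energy (fun n => n%:R * r) i n = partial_bulk r n.
Proof. by apply: eq_bigr => k _; rewrite dist_const. Qed.

Lemma row_tail x i K n T : box zmin zmax x -> (2 <= K)%N -> (K <= n)%N ->
  \sum_(K <= k < n) lam k <= T ->
  `|row_energy x i n - row_energy x i K| <= T.
Proof.
move=> bx K2 Kn; apply: le_trans.
rewrite /row_energy (big_cat_nat _ Kn) /=; last by lia.
rewrite addrAC subrr add0r; apply: le_trans (ler_norm_sum _ _ _) _.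
rewrite big_mkcond; apply: ler_sum_nat => k /andP[Kk _].
case: ifP => _; last exact: (cp_lam0 hw).
by apply: (w_tail hw); [lia|have /andP[] := box_dist i k bx].
Qed.

(** Used for particles near the ends of a chain. Nearest neighbours have energy between [w zmax] and
    [w zmin], and the other pairs are dominated by [lam]. *)
Lemma row_bounded : exists C, forall x i n, box zmin zmax x ->
  `|row_energy x i n| <= C.
Proof.
have [C HC] := cp_lamS hw.
exists (`|w zmin| + `|w zmax| + C) => x i n bx.
have C0 : 0 <= C by have := HC 0%N; rewrite big_geq.
have w0 : 0 <= `|w zmin| + `|w zmax| by rewrite addr_ge0.
apply: le_trans (ler_norm_sum _ _ _) _; rewrite big_mkcond.
have [n1|n1] := leqP n 1; first by rewrite big_geq ?addr_ge0.
rewrite big_ltn//; apply: lerD.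
  case: ifP => // _; rewrite addn1; have /andP[d1 d2] := bx i.
  have : w (x i.+1 - x i) <= w zmin by apply: (cp_dec hw) => //; exact: (cp_rz hw).
  have : w zmax <= w (x i.+1 - x i) by apply: (cp_min_le hw); have := cp_rz hw; lra.
  have := ler_norm (w zmin); have := ler_norm (- w zmax); rewrite normrN => *.
  have := normr_ge0 (w zmin); have := normr_ge0 (w zmax) => *.
  by rewrite ler_norml; apply/andP; split; lra.
apply: le_trans (HC n); rewrite [leRHS](big_cat_nat (n := 2))//=.
apply: ler_wpDl; first by apply: sumr_ge0 => k _; exact: (cp_lam0 hw).
apply: ler_sum_nat => k /andP[k2 _]; case: ifP => _; last exact: (cp_lam0 hw).
by apply: (w_tail hw) => //; have /andP[] := box_dist i k bx.
Qed.

Lemma lam_tail e : 0 < e ->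
  exists2 K, (2 <= K)%N & forall n, \sum_(K <= k < n) lam k <= e.
Proof.
move=> e0; have [K HK] := summable_tail (cp_lam0 hw) (cp_lamS hw) e0.
exists (maxn K 2); first exact: leq_maxr.
move=> n; apply: le_trans (HK n).
have [nK|Kn] := leqP n (maxn K 2).
  by rewrite big_geq// sumr_ge0// => k _; exact: (cp_lam0 hw).
rewrite [leRHS](big_cat_nat (n := maxn K 2)) //=; [|exact: leq_maxl|exact: ltnW].
by apply: ler_wpDl => //; apply: sumr_ge0 => k _; exact: (cp_lam0 hw).
Qed.

Lemma partial_bulk_cvg r : zmin <= r <= zmax -> cvgn (partial_bulk r).
Proof.
move=> rb; apply/cauchy_cvgP/cauchy_exP => e e0.
have e20 : 0 < e / 2 by rewrite divr_gt0.
have [K K2 HK] := lam_tail e20.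
exists (partial_bulk r K), K => // n /= Kn; rewrite /ball /= distrC.
apply: (@le_lt_trans _ _ (e / 2)); last by rewrite ltr_pdivrMr// ltr_pMr// ltr1n.
rewrite -!(row_const r 0); apply: row_tail => //; exact: box_const.
Qed.

Lemma w_continuous_upto K r e : zmin <= r -> 0 < e ->
  exists2 d, 0 < d & forall k y, (0 < k < K)%N -> `|y - k%:R * r| <= d ->
    `|w y - w (k%:R * r)| <= e.
Proof.
move=> zr e0; elim: K => [|K [d d0 Hd]].
  by exists 1 => // k y; rewrite ltn0 andbF.
have [K0|K0] := posnP K.
  by exists 1 => // k y; rewrite K0; lia.
have cK := cp_continuous hw (rhc_lt_muln hw K0 zr).
have [d' /= d'0 Hd'] := (cvgrPdist_le _ _).1 cK _ e0.
exists (Num.min d (d' / 2)).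
  by rewrite lt_min d0 divr_gt0.
move=> k y /andP[k0]; rewrite ltnS leq_eqVlt => /predU1P[->|kK].
  rewrite le_min => /andP[_ yd]; rewrite distrC; apply: Hd' => /=.
  by rewrite distrC (le_lt_trans yd)// ltr_pdivrMr// ltr_pMr// ltr1n.
by rewrite le_min => /andP[yd _]; apply: Hd => //; rewrite k0.
Qed.

Lemma sum_lt_le N K : (\sum_(i < N) (i < K)%N <= K)%N.
Proof.
apply: (@leq_trans (minn N K)); last exact: geq_minr.
elim: N => [|N IH]; first by rewrite big_ord0.
rewrite big_ord_recr /=; move: IH; set S := (\sum_(i < N) _)%N.
by case: ltnP => NK /=; rewrite ?addn1 ?addn0; lia.
Qed.

Lemma sum_bad_le N K1 K2 :
  (\sum_(i < N) ((i < K1) || (N <= i + K2))%N <= K1 + K2)%N.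
Proof.
apply: (@leq_trans (\sum_(i < N) ((i < K1) + (N <= i + K2)))%N).
  by apply: leq_sum => i _; move: (i < K1)%N (N <= i + K2)%N => [] [].
rewrite big_split /=; apply: leq_add; first exact: sum_lt_le.
apply: leq_trans (sum_lt_le N K2); rewrite (reindex_inj rev_ord_inj) /=.
apply: leq_sum => i _; have iN := ltn_ord i.
by have -> : (N <= N - i.+1 + K2)%N = (i < K2)%N by move: iN; clear; lia.
Qed.

(** In the bulk a row differs from [bulk r] by at most [e], a quarter each from the tail of the row,
    the continuity of [w] at finitely many distances, the tail of the limit and the pressure term.
    The number of rows near the ends is bounded independently of [N], and each is off by at most
    [D]; dividing by [N] removes them. *)
Lemma energy_density (X : nat -> nat -> R) r :
  (forall N, box zmin zmax (X N)) -> zmin <= r <= zmax ->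
  (forall e, 0 < e -> exists K, forall N q, (K <= q)%N -> (q + K.+1 < N)%N ->
     `|spacing (X N) q - r| <= e) ->
  E N (X N) / N%:R @[N --> \oo] --> bulk r.
Proof.
move=> bX rb HX; have z0 := zmin_gt0 hw; have zz := cp_zz hw.
have [C HC] := row_bounded.
pose D := C + p * zmax + `|bulk r|.
have C0 : 0 <= C by apply: le_trans (HC _ 0%N 0%N (box_const rb)); exact: normr_ge0.
have pz0 : 0 <= p * zmax by rewrite mulr_ge0//; lra.
have D0 : 0 <= D by rewrite !addr_ge0.
have psp x q : box zmin zmax x -> `|p * spacing x q| <= p * zmax.
  move=> bx; have /andP[s1 s2] := bx q.
  rewrite normrM (ger0_norm p0) ger0_norm; last by rewrite /spacing; lra.
  exact: ler_wpM2l.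
suff key e : 0 < e -> exists M, forall N,
    `|E N.+1 (X N.+1) - N.+1%:R * bulk r| <= N.+1%:R * e + M.
  apply/cvgrPdist_le => e e0.
  have e20 : 0 < e / 2 by rewrite divr_gt0.
  have [M HM] := key _ e20.
  have [N0 N0M] : exists N0 : nat, M * 2 / e <= N0%:R.
    by exists (Num.trunc `|M * 2 / e|).+1; apply: le_trans (ler_norm _) _;
       apply/ltW/truncnS_gt.
  exists N0.+1 => // -[|N]//= NN0; rewrite distrC.
  have Npos : 0 < N.+1%:R :> R by rewrite ltr0n.
  rewrite -[X in _ - X](mulKf (lt0r_neq0 Npos)) mulrC -mulrBr normrM gtr0_norm ?invr_gt0//.
  rewrite mulrC ler_pdivrMr//; apply: le_trans (HM N) _.
  have : M * 2 / e <= N.+1%:R by apply: le_trans N0M _; rewrite ler_nat; exact: ltnW.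
  rewrite ler_pdivrMr//; nra.
move=> e0.
have e40 : 0 < e / 4 by rewrite divr_gt0.
have [K K2 HK] := lam_tail e40.
have K0 : 0 < K%:R :> R by rewrite ltr0n; exact: leq_trans K2.
have [d d0 Hd] := w_continuous_upto K (proj1 (andP rb)) (divr_gt0 e40 K0).
have p1 : 0 < p + 1 by rewrite ltr_wpDl.
(* If the spacings are within [c] of [r], a distance of fewer than [K] spacings is off by at most
   [K * c <= d]. Dividing by [p + 1] rather than [p] allows [p = 0]. *)
pose c := Num.min (d / K%:R) (e / 4 / (p + 1)).
have c0 : 0 < c by rewrite lt_min !divr_gt0.
have [K1 HK1] := HX _ c0.
exists (D * (K1 + (K + K1.+1))%:R + p * zmax) => N.
have bN := bX N.+1; set x := X N.+1 in bN *.
have -> : E N.+1 x = (E N.+1 x + p * spacing x N) - p * spacing x N by rewrite addrK.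
rewrite chain_energy_rows.
have -> : N.+1%:R * bulk r = \sum_(i < N.+1) bulk r.
  by rewrite sumr_const card_ord mulr_natl.
rewrite addrAC -sumrB; apply: le_trans (ler_normB _ _) _.
rewrite addrA; apply: lerD; last exact: psp.
apply: le_trans (ler_norm_sum _ _ _) _.
(* If [i] is not bad, the spacings [i] to [i + K - 1] all have depth [K1]. *)
pose bad i := (i < K1)%N || (N.+1 <= i + (K + K1.+1))%N.
apply: (@le_trans _ _ (\sum_(i < N.+1) (e + D * (bad i)%:R))); last first.
  rewrite big_split /= sumr_const card_ord mulr_natl lerD2l -mulr_sumr.
  by apply: ler_wpM2l => //; rewrite -natr_sum ler_nat; exact: sum_bad_le.
apply: ler_sum => i _; case Hbad: (bad i).
  rewrite mulr1 -[leLHS]add0r; apply: lerD; first exact: ltW.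
  apply: le_trans (ler_normB _ _) _; rewrite lerD2r.
  by apply: le_trans (ler_normD _ _) _; apply: lerD; [exact: HC|exact: psp].
move/negbT: Hbad; rewrite negb_or -leqNgt -ltnNge => /andP[i1 i2].
rewrite mulr0 addr0.
have near0 l : (l < K)%N -> `|spacing x (i + l)%N - r| <= c.
  by move=> lK; apply: HK1; move: i1 i2 lK; clear; lia.
have H1 : `|row_energy x i (N.+1 - i) - row_energy x i K| <= e / 4.
  by apply: row_tail => //; move: i2; clear; lia.
have H2 : `|row_energy x i K - partial_bulk r K| <= e / 4.
  rewrite /row_energy /partial_bulk -sumrB.
  apply: le_trans (ler_norm_sum _ _ _) _.
  apply: (@le_trans _ _ (\sum_(1 <= k < K) e / 4 / K%:R)).
    rewrite big_mkcond; apply: ler_sum_nat => k /andP[k1 kK].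
    case: ifP => _; last by rewrite ltW// divr_gt0.
    apply: Hd; first by rewrite k1.
    rewrite -(dist_const r i k).
    apply: (@le_trans _ _ (k%:R * c)).
      apply: (@dist_diff _ x (fun n => n%:R * r) i i k c) => l lk; rewrite /spacing -[(i + l).+1]addn1.
      rewrite dist_const mul1r.
      by rewrite addn1; apply: near0; exact: ltn_trans kK.
    apply: (@le_trans _ _ (K%:R * (d / K%:R))); last by rewrite mulrC divfK// lt0r_neq0.
    by apply: ler_pM => //; [exact: ltW|rewrite ler_nat ltnW|rewrite ge_min lexx].
  rewrite sumr_const_nat; apply: (@le_trans _ _ (e / 4 / K%:R *+ K)).
    rewrite -[leRHS]mulr_natl -[leLHS]mulr_natl ler_wpM2r ?ler_nat ?leq_subr//.
    by rewrite ltW// divr_gt0.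
  by rewrite -(mulr_natr (e / 4 / K%:R)) divfK// lt0r_neq0.
have H3 : `|partial_bulk r K - limn (partial_bulk r)| <= e / 4.
  have cl : `|partial_bulk r K - partial_bulk r n| @[n --> \oo] -->
      `|partial_bulk r K - limn (partial_bulk r)|.
    apply: cvg_norm; apply: cvgB; first exact: cvg_cst.
    exact: partial_bulk_cvg.
  rewrite -(cvg_lim _ cl)//; apply: limr_le; first by apply/cvg_ex; eexists; exact: cl.
  exists K => // n /= Kn; rewrite distrC -!(row_const r 0); apply: row_tail => //.
  exact: box_const.
have H4 : `|p * spacing x i - p * r| <= e / 4.
  rewrite -mulrBr normrM ger0_norm//.
  have Hc : `|spacing x i - r| <= c.
    by have := near0 0%N; rewrite addn0; apply; exact: leq_trans K2.
  apply: (@le_trans _ _ ((p + 1) * (e / 4 / (p + 1)))).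
    apply: ler_pM => //; first by rewrite lerDl.
    by apply: le_trans Hc _; rewrite ge_min lexx orbT.
  by rewrite mulrC divfK// lt0r_neq0.
rewrite /bulk.
move: H1 H2 H3 H4; clear.
set a1 := row_energy _ _ _; set a2 := row_energy _ _ _; set a3 := partial_bulk _ _.
set a4 := limn _; set b1 := p * _; set b2 := p * _.
rewrite !ler_norml => /andP[? ?] /andP[? ?] /andP[? ?] /andP[? ?].
apply/andP; split; lra.
Qed.

End density.

(** * Convexity and minimizer of the bulk energy *)

Section bulk_convexity.
Context {R : realType}.
Variables (w w1 w2 : R -> R) (rhc zmin zmax Q : R).
Variables (tau : nat -> R -> R) (lam : nat -> R).
Hypothesis hw : chain_potential w w1 w2 rhc zmin zmax Q tau lam.
Variables (m : option nat) (p : R).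
Hypothesis hm : m <> Some 0%N.

Lemma partial_bulk1 r n : (2 <= n)%N -> partial_bulk w m r n =
  w r + \sum_(2 <= k < n | in_range m k) w (k%:R * r).
Proof.
by move=> n2; rewrite /partial_bulk big_mkcond big_ltn// (in_range1 hm) mul1r -big_mkcond.
Qed.

(** With [T] the sum of the [tau k r], the core inequality gives
    [w r - T >= T - w zmax >= - w zmax]. *)
Lemma partial_bulk_ge_core r n : rhc < r -> r <= zmin ->
  - w zmax <= partial_bulk w m r n.+2.
Proof.
move=> rr rz; rewrite partial_bulk1//.
have core : 2 * \sum_(2 <= k < n.+2) tau k r <= w r + w zmax.
  move: rz; rewrite le_eqVlt => /predU1P[->|rz]; first exact: (cp_core_zmin hw).
  exact/ltW/(cp_core hw).
have tau0 : 0 <= \sum_(2 <= k < n.+2) tau k r.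
  by apply: sumr_ge0 => k _; exact: (cp_tau0 hw).
have : - \sum_(2 <= k < n.+2) tau k r <= \sum_(2 <= k < n.+2 | in_range m k) w (k%:R * r).
  rewrite -sumrN [leRHS]big_mkcond; apply: ler_sum_nat => k /andP[k2 _].
  case: ifP => _; last by rewrite oppr_le0 (cp_tau0 hw).
  exact: (cp_low hw).
lra.
Qed.

Lemma partial_bulk_lower r : rhc < r -> exists C, forall n, C <= partial_bulk w m r n.+2.
Proof.
move=> rr; have [rz|zr] := leP r zmin.
  by exists (- w zmax) => n; exact: partial_bulk_ge_core.
have [C HC] := cp_lamS hw.
exists (w zmax - C) => n; rewrite partial_bulk1//; apply: lerD.
  exact: (cp_min_le hw).
apply: (@le_trans _ _ (- \sum_(2 <= k < n.+2) lam k)).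
  rewrite lerN2; apply: le_trans (HC n.+2); rewrite [leRHS](big_cat_nat (n := 2))//=.
  by apply: ler_wpDl => //; apply: sumr_ge0 => k _; exact: (cp_lam0 hw).
rewrite -sumrN [leRHS]big_mkcond; apply: ler_sum_nat => k /andP[k2 _].
case: ifP => _; last by rewrite oppr_le0 (cp_lam0 hw).
rewrite lerNl; have : `|w (k%:R * r)| <= lam k.
  by apply: (w_tail hw) => //; rewrite ler_wpM2l// ltW.
by apply: le_trans; rewrite -normrN ler_norm.
Qed.

(** The terms with [k * r >= zmax] are nonpositive, so the partial sums eventually decrease, and
    they are bounded below. *)
Lemma partial_bulk_is_cvg r : rhc < r -> cvgn (partial_bulk w m r).
Proof.
move=> rr; have r0 : 0 < r by apply: le_lt_trans rr; exact: (cp_rhc hw).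
have [C HC] := partial_bulk_lower rr.
have [K HK] : exists K : nat, zmax / r <= K%:R.
  by exists (Num.trunc `|zmax / r|).+1; apply: le_trans (ler_norm _) _; apply/ltW/truncnS_gt.
apply: (@near_nonincreasing_is_cvgn _ _ C).
  exists K.+2 => // n /= Kn k nk.
  rewrite /partial_bulk (big_cat_nat (n := n) _ nk) /=; last by lia.
  rewrite gerDl big_mkcond -oppr_ge0 -sumrN big_nat; apply: sumr_ge0 => i /andP[ni _].
  case: ifP => _; last by rewrite oppr0.
  rewrite oppr_ge0; apply: (cp_nonpos hw).
  by move: HK; rewrite ler_pdivrMr// => /le_trans -> //; rewrite ler_pM2r// ler_nat; lia.
exists 2%N => // -[|[|n]]//= _; exact: HC.
Qed.

Lemma bulk_ge r C n0 : rhc < r ->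
  (forall n, (n0 <= n)%N -> C <= partial_bulk w m r n) -> p * r + C <= bulk w m p r.
Proof.
move=> rr H; rewrite /bulk lerD2l; apply: limr_ge; first exact: partial_bulk_is_cvg.
by exists n0.
Qed.

Lemma bulk_le r C n0 : rhc < r ->
  (forall n, (n0 <= n)%N -> partial_bulk w m r n <= C) -> bulk w m p r <= p * r + C.
Proof.
move=> rr H; rewrite /bulk lerD2l; apply: limr_le; first exact: partial_bulk_is_cvg.
by exists n0.
Qed.

(** In the second difference with step [h] the nearest-neighbour term gives at least
    [w2 zmax * h ^+ 2]. The term [k] has step [k * h] and the rest lose at most [Q * h ^+ 2]; the
    gap does not depend on [n], so strictness survives the limit. *)
Lemma bulk_midpoint x h : zmin <= x -> 0 < h -> x + 2 * h <= zmax ->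
  2 * bulk w m p (x + h) < bulk w m p x + bulk w m p (x + 2 * h).
Proof.
move=> zx h0 hz; have z0 := zmin_gt0 hw; have rz := cp_rz hw.
have QK := cp_QK hw.
have step n : (2 <= n)%N -> (w2 zmax - Q) * h ^+ 2 <=
    partial_bulk w m x n + partial_bulk w m (x + 2 * h) n - 2 * partial_bulk w m (x + h) n.
  move=> n2; rewrite !partial_bulk1//.
  have H1 : w2 zmax * h ^+ 2 <= w x + w (x + 2 * h) - 2 * w (x + h).
    apply: (w_midpoint hw); [lra|lra|] => c /andP[c1 c2].
    apply: (cp_w2dec hw); lra.
  have H2 : - (Q * h ^+ 2) <= \sum_(2 <= k < n | in_range m k) w (k%:R * x)
     + \sum_(2 <= k < n | in_range m k) w (k%:R * (x + 2 * h))
     - 2 * \sum_(2 <= k < n | in_range m k) w (k%:R * (x + h)).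
    rewrite mulr_sumr -big_split -sumrB /= big_mkcond.
    apply: (@le_trans _ _ (- (\sum_(2 <= k < n) k%:R ^+ 2 * - w2 (k%:R * zmin) * h ^+ 2))).
      rewrite lerN2 -mulr_suml; apply: ler_wpM2r; last exact: (cp_Q hw).
      by rewrite exprn_ge0// ltW.
    rewrite -sumrN; apply: ler_sum_nat => k /andP[k2 _].
    have kz := muln_2zmin hw k2.
    have w2k : w2 (k%:R * zmin) <= 0 by exact: (cp_w2np hw).
    have kx : k%:R * zmin <= k%:R * x by rewrite ler_wpM2l.
    case: ifP => _; last first.
      rewrite oppr_le0; apply: mulr_ge0; last by rewrite exprn_ge0// ltW.
      by apply: mulr_ge0; rewrite ?exprn_ge0// oppr_ge0.
    have -> : - (k%:R ^+ 2 * - w2 (k%:R * zmin) * h ^+ 2)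
      = w2 (k%:R * zmin) * (k%:R * h) ^+ 2 by ring.
    have -> : k%:R * (x + 2 * h) = k%:R * x + 2 * (k%:R * h) by ring.
    have -> : k%:R * (x + h) = k%:R * x + k%:R * h by ring.
    apply: (w_midpoint hw); [lra|by rewrite mulr_ge0// ltW|] => c /andP[c1 _].
    by apply: (cp_w2inc hw) => //; exact: le_trans c1.
  lra.
have cx : cvgn (partial_bulk w m x) by apply: partial_bulk_is_cvg; lra.
have cy : cvgn (partial_bulk w m (x + 2 * h)) by apply: partial_bulk_is_cvg; lra.
have cz : cvgn (partial_bulk w m (x + h)) by apply: partial_bulk_is_cvg; lra.
have cl : partial_bulk w m x n + partial_bulk w m (x + 2 * h) n - 2 * partial_bulk w m (x + h) n
   @[n --> \oo] --> limn (partial_bulk w m x) + limn (partial_bulk w m (x + 2 * h))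
     - 2 * limn (partial_bulk w m (x + h)).
  by apply: cvgB; [exact: cvgD|exact: cvgMr].
have : (w2 zmax - Q) * h ^+ 2 <= limn (partial_bulk w m x)
     + limn (partial_bulk w m (x + 2 * h)) - 2 * limn (partial_bulk w m (x + h)).
  rewrite -(cvg_lim _ cl)//; apply: limr_ge; first by apply/cvg_ex; eexists; exact: cl.
  by exists 2%N.
have : 0 < (w2 zmax - Q) * h ^+ 2 by rewrite mulr_gt0 ?exprn_gt0// subr_gt0.
rewrite /bulk; lra.
Qed.

End bulk_convexity.

Section bulk_minimality.
Context {R : realType}.
Variables (w w1 w2 : R -> R) (rhc zmin zmax Q : R).
Variables (tau : nat -> R -> R) (lam : nat -> R).
Hypothesis hw : chain_potential w w1 w2 rhc zmin zmax Q tau lam.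
Variables (m : option nat) (p : R).
Hypotheses (hm : m <> Some 0%N) (p0 : 0 <= p) (pneg : p * zmax + w zmax < 0).
Local Notation E := (chain_energy w m p).

Lemma rhc_lt_zmax : rhc < zmax.
Proof. exact: lt_trans (cp_rz hw) (cp_zz hw). Qed.

Lemma bulk_zmax_lt0 : bulk w m p zmax < 0.
Proof.
apply: le_lt_trans pneg; apply: (bulk_le hw p hm (n0 := 2)); first exact: rhc_lt_zmax.
move=> [|[|n]]// _; rewrite (partial_bulk1 _ hm)// gerDl big_mkcond -oppr_ge0 -sumrN big_nat.
apply: sumr_ge0 => k /andP[k2 _]; case: ifP => _; last by rewrite oppr0.
rewrite oppr_ge0; apply: (cp_nonpos hw).
by rewrite ler_peMl ?ler1n ?ltW ?(le_lt_trans (cp_rhc hw) rhc_lt_zmax)//; lia.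
Qed.

Lemma bulk_gt0 r : rhc < r -> r <= zmin -> 0 < bulk w m p r.
Proof.
move=> rr rz; apply: (@lt_le_trans _ _ (p * r + - w zmax)).
  rewrite ltr_wpDl ?oppr_gt0 ?(cp_neg hw)// mulr_ge0// ltW//.
  exact: le_lt_trans (cp_rhc hw) rr.
by apply: (bulk_ge hw p hm (n0 := 2)) => // -[|[|n]]// _; exact: (partial_bulk_ge_core hw hm).
Qed.

(** The nearest-neighbour term gains the fixed amount [w r - w zmax > 0] and no other term
    decreases; carrying this amount through the limit keeps the inequality strict. *)
Lemma bulk_gt_zmax r : zmax < r -> bulk w m p zmax < bulk w m p r.
Proof.
move=> zr; have rr := lt_trans rhc_lt_zmax zr.
apply: (@lt_le_trans _ _ (p * zmax + (limn (partial_bulk w m zmax) + (w r - w zmax)))).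
  by rewrite addrA ltrDl subr_gt0; apply: (cp_min hw) => //; rewrite gt_eqF.
rewrite /bulk; apply: lerD; first by rewrite ler_wpM2l// ltW.
have cz : partial_bulk w m zmax n + (w r - w zmax) @[n --> \oo] -->
    limn (partial_bulk w m zmax) + (w r - w zmax).
  by apply: cvgD; [exact: (partial_bulk_is_cvg hw hm rhc_lt_zmax)|exact: cvg_cst].
apply: ler_cvg_to cz (partial_bulk_is_cvg hw hm rr) _.
exists 2%N => // n /= n2; rewrite !(partial_bulk1 _ hm)//.
have : \sum_(2 <= k < n | in_range m k) w (k%:R * zmax) <=
    \sum_(2 <= k < n | in_range m k) w (k%:R * r).
  rewrite big_mkcond [leRHS]big_mkcond; apply: ler_sum_nat => k /andP[k2 _].
  case: ifP => // _; apply: (cp_inc hw); last by rewrite ler_wpM2l// ltW.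
  by rewrite ler_peMl ?ler1n ?ltW ?(le_lt_trans (cp_rhc hw) rhc_lt_zmax)//; lia.
lra.
Qed.

(** Inside the box, dividing the comparison of [X N] with an equispaced chain by [N] gives
    minimality of [a] in the limit. Up to [zmin] the bulk energy is positive while it is negative at
    [zmax], and beyond [zmax] it exceeds its value at [zmax]. *)
Lemma bulk_minimizer (X : nat -> nat -> R) a :
  (forall N, box zmin zmax (X N)) ->
  (forall N y, (forall l, rhc < y l.+1 - y l) -> E N.+1 (X N.+1) <= E N.+1 y) ->
  zmin <= a <= zmax -> E N (X N) / N%:R @[N --> \oo] --> bulk w m p a ->
  zmin < a /\ forall r, rhc < r -> r != a -> bulk w m p a < bulk w m p r.
Proof.
move=> bX mX ab cX.
have inbox r : zmin <= r <= zmax -> bulk w m p a <= bulk w m p r.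
  move=> rb; have bc := box_const rb.
  have cr : E N (fun n => n%:R * r) / N%:R @[N --> \oo] --> bulk w m p r.
    have := @energy_density _ _ _ _ _ _ _ _ _ _ hw m p p0 (fun _ n => n%:R * r) r (fun=> bc) rb.
    apply=> e e0.
    exists 0%N => N q _ _; rewrite /spacing -[q.+1]addn1 dist_const mul1r subrr normr0.
    exact: ltW.
  apply: ler_cvg_to cX cr _; exists 1%N => // -[|N]//= _.
  rewrite ler_pM2r ?invr_gt0 ?ltr0n//; apply: mX; exact: (box_gt_rhc hw).
have zz := cp_zz hw; have rz := cp_rz hw.
have azmax : bulk w m p a <= bulk w m p zmax by apply: inbox; rewrite lexx ltW.
have za : zmin < a.
  rewrite ltNge; apply/negP => az.
  have ra : rhc < a by have /andP[] := ab; lra.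
  by have := bulk_gt0 ra az; have := bulk_zmax_lt0; lra.
split=> // r rr rNa.
have [rz'|zr] := leP r zmin.
  by have := bulk_gt0 rr rz'; have := bulk_zmax_lt0; lra.
have [rz'|zr'] := leP r zmax; last exact: le_lt_trans (bulk_gt_zmax zr').
rewrite lt_neqAle inbox ?rz' ?(ltW zr)// andbT; apply/negP => /eqP e.
(* Two minimizers in the box would have a midpoint of strictly smaller bulk energy. *)
have mid lo hi : zmin <= lo -> lo < hi -> hi <= zmax ->
    bulk w m p lo = bulk w m p a -> bulk w m p hi = bulk w m p a -> False.
  move=> zlo lohi hiz elo ehi.
  have h0 : 0 < (hi - lo) / 2 by rewrite divr_gt0// subr_gt0.
  have hE : lo + 2 * ((hi - lo) / 2) = hi by lra.
  have := bulk_midpoint hw p hm zlo h0; rewrite hE elo ehi => /(_ hiz).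
  have : bulk w m p a <= bulk w m p (lo + (hi - lo) / 2).
    by apply: inbox; apply/andP; split; lra.
  lra.
have /andP[a1 a2] := ab.
have [ra|ar|era] := ltgtP r a; last by rewrite era eqxx in rNa.
  by apply: (mid r a) => //; exact: ltW.
by apply: (mid a r).
Qed.

End bulk_minimality.

(** * Extended real energies *)

Section from_assumptionV.
Context {R : realType}.
Variables (v : R -> \bar R) (rhc zmin zmax alpha1 alpha2 s : R).
Hypothesis hV : assumptionV v rhc zmin zmax alpha1 alpha2 s.

Local Notation w := (vreal v).

Lemma powR_antitone x y : 0 < x -> x <= y -> y `^ (- s) <= x `^ (- s).
Proof.
move=> x0 xy; have y0 := lt_le_trans x0 xy; have := V_s hV => s2.
rewrite !powRN lef_pV2 ?posrE ?powR_gt0//.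
have s0 : 0 <= s by lra.
by rewrite ge0_ler_powR// nnegrE ltW.
Qed.

Lemma vrealK z : rhc < z -> (w z)%:E = v z.
Proof. by move=> /(V_finite hV) vz; rewrite /vreal fineK. Qed.

Lemma rhc_zmax : rhc < zmax.
Proof. exact: lt_trans (V_rhc_zmin hV) (V_zmin_zmax hV). Qed.

Definition power_bound (k : nat) (r : R) : R := alpha1 * (k%:R * r) `^ (- s).

Lemma power_bound_ge0 k r : 0 <= power_bound k r.
Proof. by rewrite mulr_ge0 ?powR_ge0// ltW// (V_alpha1 hV). Qed.

Lemma power_bound_low k r d : (0 < k)%N -> 0 < r -> k%:R * r <= d -> rhc < d ->
  - power_bound k r <= w d.
Proof.
move=> k0 r0 krd rd; have kr0 : 0 < k%:R * r by rewrite mulr_gt0// ltr0n.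
have := V_lower hV (lt_le_trans kr0 krd); rewrite -vrealK// lee_fin.
apply: le_trans; rewrite lerN2; apply: ler_wpM2l; first exact/ltW/(V_alpha1 hV).
exact: powR_antitone.
Qed.

(** The partial sums of a nonnegative series stay below its value, so the inequality in [V_core]
    survives truncation. *)
Lemma core_partial n r : rhc < r -> r < zmin ->
  2 * \sum_(2 <= k < n) power_bound k r < w r + w zmax.
Proof.
move=> rr rz; have r0 := le_lt_trans (V_rhc_ge0 hV) rr.
have := V_core hV r0 rz; rewrite -!vrealK ?rhc_zmax// => core.
have : (0 < (w r)%:E + (w zmax)%:E - (2 * alpha1)%:E *
    (\sum_(2 <= k < n) (k%:R * r) `^ (- s))%:E)%E.
  apply: lt_le_trans core _; apply: leeB => //; apply: lee_wpmul2l.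
    by rewrite lee_fin mulr_ge0// ltW// (V_alpha1 hV).
  rewrite -sumEFin; apply: nneseries_lim_ge => k _ _.
  by rewrite lee_fin powR_ge0.
rewrite -EFinM -EFinN -!EFinD lte_fin subr_gt0 /power_bound -mulr_sumr.
by rewrite mulrA.
Qed.

Lemma w_is_derive z : rhc < z -> is_derive z 1 w (derive1 w z).
Proof. by move=> /(V_C2 hV)[d _ _]; rewrite derive1E; exact: derivableP. Qed.

Lemma w1_is_derive z : rhc < z -> is_derive z 1 (derive1 w) (Defs.d2 v z).
Proof.
move=> /(V_C2 hV)[_ d _].
rewrite /Defs.d2 /derive1n /= derive1E; exact: derivableP.
Qed.

(** The endpoint follows by continuity of [w]: if the inequality failed at [zmin], then slightly
    below [zmin] the potential would change by less than the defect while the sum is no smaller,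
    against [core_partial]. *)
Lemma core_zmin n :
  2 * \sum_(2 <= k < n) power_bound k zmin <= w zmin + w zmax.
Proof.
have rz := V_rhc_zmin hV; have r0 := V_rhc_ge0 hV.
set T := _ * _; rewrite leNgt; apply/negP => H.
have e0 : 0 < T - (w zmin + w zmax) by rewrite subr_gt0.
have cw : {for zmin, continuous w}.
  apply: differentiable_continuous; apply/derivable1_diffP.
  by have [dw _ _] := V_C2 hV rz.
have [d /= d0 Hd] := (cvgrPdist_lt _ _).1 cw _ e0.
pose z := zmin - Num.min (d / 2) ((zmin - rhc) / 2).
have m0 : 0 < Num.min (d / 2) ((zmin - rhc) / 2) by rewrite lt_min !divr_gt0// subr_gt0.
have md : Num.min (d / 2) ((zmin - rhc) / 2) <= d / 2 by rewrite ge_min lexx.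
have mz : Num.min (d / 2) ((zmin - rhc) / 2) <= (zmin - rhc) / 2 by rewrite ge_min lexx orbT.
have rz' : rhc < z by rewrite /z; lra.
have zz' : z < zmin by rewrite /z; lra.
have zd : `|zmin - z| < d by rewrite /z opprB addrC subrK gtr0_norm//; lra.
have := Hd _ zd; rewrite ltr_norml => /andP[h1 h2].
have core := core_partial n rz' zz'.
have : T <= 2 * \sum_(2 <= k < n) power_bound k z.
  rewrite /T ler_pM2l//; apply: ler_sum_nat => k /andP[k2 _].
  have k0 : 0 < k%:R :> R by rewrite ltr0n; exact: ltnW.
  apply: ler_wpM2l; first exact/ltW/(V_alpha1 hV).
  by apply: powR_antitone; [rewrite mulr_gt0//; lra|rewrite ler_pM2l// ltW].
lra.
Qed.

(** The core inequality at a point [z] between [rhc] and [zmin] bounds the sums of [power_bound k z]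
    uniformly in [n]. The point [zmin / 2] may lie below [rhc], but passing to it from [z]
    multiplies each term by the constant [c]. *)
Lemma power_bound_summable : exists C, forall n,
  \sum_(0 <= k < n) power_bound k (zmin / 2) <= C.
Proof.
have rz := V_rhc_zmin hV; have r0 := V_rhc_ge0 hV.
pose z := (rhc + zmin) / 2.
have rz' : rhc < z by rewrite /z; lra.
have zz' : z < zmin by rewrite /z; lra.
pose c := (zmin / 2 / z) `^ (- s).
have c0 : 0 <= c by exact: powR_ge0.
have pE k : power_bound k (zmin / 2) = c * power_bound k z.
  rewrite /power_bound [RHS]mulrCA /c -powRM//; [|by rewrite ?divr_ge0//; lra|by rewrite mulr_ge0//; lra].
  congr (_ * _ `^ _); rewrite [RHS]mulrCA divfK//; apply: lt0r_neq0; lra.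
exists (power_bound 0 (zmin / 2) + power_bound 1 (zmin / 2) + c * ((w z + w zmax) / 2)) => n.
apply: (@le_trans _ _ (\sum_(0 <= k < n.+2) power_bound k (zmin / 2))).
  apply: (@ler_sum_widen _ (power_bound ^~ (zmin / 2)) 0 n n.+2) => [k|].
    exact: power_bound_ge0.
  by rewrite -addn2 leq_addr.
rewrite big_ltn// big_ltn// addrA lerD2l (eq_bigr _ (fun k _ => pE k)) -mulr_sumr.
by apply: ler_wpM2l => //; rewrite ler_pdivlMr// mulrC; exact/ltW/core_partial.
Qed.

(** [Q] is minus the value of the series in [V_d2_pos]. Its terms are nonpositive, so it lies below
    its partial sums, and the positivity assumption excludes the value [-oo]. *)
Lemma curvature_sum : exists2 Q,
  forall n, \sum_(2 <= k < n) k%:R ^+ 2 * - Defs.d2 v (k%:R * zmin) <= Q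
  & Q < Defs.d2 v zmax.
Proof.
have rz := V_rhc_zmin hV; have r0 := V_rhc_ge0 hV; have z0 : 0 < zmin by lra.
have f0 k : (2 <= k)%N -> k%:R ^+ 2 * Defs.d2 v (k%:R * zmin) <= 0.
  move=> k2; rewrite mulr_ge0_le0 ?exprn_ge0//; apply: (V_d2_nonpos hV).
  by rewrite ler_pM2r// ler_nat.
set S : \bar R := (\sum_(2 <= n <oo) (n%:R ^+ 2 * Defs.d2 v (n%:R * zmin))%:E)%E.
have Spart n : (S <= (\sum_(2 <= k < n) k%:R ^+ 2 * Defs.d2 v (k%:R * zmin))%:E)%E.
  apply: lime_le; first by apply: is_cvg_npeseries => k k2 _; rewrite lee_fin f0.
  exists n => // k /= nk; rewrite sumEFin lee_fin.
  have [n2|n2] := leqP n 2.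
    rewrite (big_geq n2) -oppr_ge0 -sumrN big_nat; apply: sumr_ge0 => i /andP[i2 _].
    by rewrite oppr_ge0 f0.
  rewrite (big_cat_nat _ nk) /=; last exact: ltnW.
  rewrite gerDl -oppr_ge0 -sumrN big_nat; apply: sumr_ge0 => i /andP[ni _].
  by rewrite oppr_ge0 f0//; lia.
have := V_d2_pos hV; rewrite -/S => Spos.
have S0 := Spart 0%N; rewrite big_geq// in S0.
case ES: S => [q| |]; rewrite ES in Spart Spos S0.
- exists (- q) => [n|]; last by move: Spos; rewrite -EFinD lte_fin; lra.
  have := Spart n; rewrite lee_fin => Hn.
  under eq_bigr do rewrite mulrN.
  by rewrite sumrN lerN2.
- by move: S0; rewrite leye_eq.
- by move: Spos; rewrite addeNy ltNge leNye.
Qed.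

Lemma chain_potential_vreal : exists Q,
  chain_potential w (derive1 w) (Defs.d2 v) rhc zmin zmax Q power_bound
    (power_bound ^~ (zmin / 2)).
Proof.
have [Q HQ HQK] := curvature_sum; exists Q.
have rz := V_rhc_zmin hV; have r0 := V_rhc_ge0 hV; have z0 : 0 < zmin by lra.
have zz := V_zmin_zmax hV; have rzm := rhc_zmax.
have wmin z : rhc < z -> z != zmax -> w zmax < w z.
  move=> rz1 zN; have [[_ vmin] vuniq] := V_zmax_minimizer hV.
  have z1 : 0 < z by lra.
  rewrite ltNge; apply: contra zN => wz; apply/eqP/esym/vuniq.
  split=> // y y0; apply: le_trans (vmin y y0); rewrite -!vrealK//.
have wminle z : rhc < z -> w zmax <= w z.
  by move=> ?; have [->//|] := eqVneq z zmax => zN; apply/ltW/wmin.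
have wnonpos a : zmax <= a -> w a <= 0.
  rewrite le_eqVlt => /predU1P[<-|za].
    by have := V_zmax_neg hV; rewrite -vrealK// lte_fin => /ltW.
  by have := V_nonpos hV za; rewrite -vrealK ?lee_fin//; lra.
split.
- exact: r0.
- exact: rz.
- exact: zz.
- exact: V_zmax_2zmin hV.
- exact: w_is_derive.
- exact: w1_is_derive.
- exact: wmin.
- by have := V_zmax_neg hV; rewrite -vrealK// lte_fin.
(* The assumption gives monotonicity on the open sides of [zmax]; the point [zmax] itself is added
   by minimality. *)
- move=> a b ra ab; rewrite le_eqVlt => /predU1P[->|bz]; first exact: wminle.
  have a0 : 0 < a by lra.
  by have := V_decreasing hV a0 ab bz; rewrite -!vrealK ?lee_fin//; lra.
- move=> a b; rewrite le_eqVlt => /predU1P[<- zb|za ab]; first by apply: wminle; lra.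
  by have := V_increasing hV za ab; rewrite -!vrealK ?lee_fin//; lra.
- exact: wnonpos.
- exact: power_bound_ge0.
- move=> k r d k2 rr rzm' krd; have r1 : 0 < r by lra.
  apply: power_bound_low => //; first by lia.
  apply: lt_le_trans rr _; apply: le_trans krd; rewrite ler_peMl ?ler1n ?ltW//; lia.
- by move=> *; exact: core_partial.
- exact: core_zmin.
- by move=> k; exact: power_bound_ge0.
- move=> k d k0 rd kd; apply: power_bound_low => //; lra.
- exact: power_bound_summable.
- exact: V_d2_decreasing hV.
- exact: V_d2_increasing hV.
- exact: V_d2_nonpos hV.
- exact: HQ.
- exact: HQK.
Qed.

End from_assumptionV.

(** * Minimization in the extended reals and the thermodynamic limit *)

Section from_ereal.
Context {R : realType}.
Variables (v : R -> \bar R) (rhc zmin zmax alpha1 alpha2 s Q : R).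
Hypothesis hV : assumptionV v rhc zmin zmax alpha1 alpha2 s.
Variables (tau : nat -> R -> R) (lam : nat -> R).
Local Notation w := (vreal v).
Hypothesis hw : chain_potential w (derive1 w) (Defs.d2 v) rhc zmin zmax Q tau lam.
Variables (m : option nat) (p : R).
Hypotheses (hm : m <> Some 0%N) (p0 : 0 <= p) (pneg : p * zmax + w zmax < 0).

Local Notation E := (chain_energy w m p).
Local Notation pos := (position_of zmax).

Lemma position_sub n (z : 'rV[R]_n) i j : (i <= j <= n)%N ->
  pos z j - pos z i = \sum_(k < n | (i <= k < j)%N) z ord0 k.
Proof.
move=> /andP[ij jn].
under [RHS]eq_bigr do rewrite -(spacing_of_ord zmax).
rewrite -(big_mkord (fun k => (i <= k < j)%N) (spacing_of zmax z)).
rewrite /position_of -!(big_mkord xpredT (spacing_of zmax z)).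
rewrite (big_cat_nat (n := i) _ ij)//= addrAC subrr add0r.
rewrite (big_nat_widen _ _ _ _ _ jn) (big_nat_widenl _ 0)//=.
by apply: eq_bigl => k; rewrite andbC.
Qed.

Lemma vreal_gtNy d : 0 < d -> v d != -oo%E.
Proof. by move=> /(V_lower hV) H; rewrite gt_eqF// (lt_le_trans _ H)// ltNyr. Qed.

Lemma position_lt n (z : 'rV[R]_n) i j : (forall k, 0 < z ord0 k) -> (i < j)%N ->
  0 < pos z j - pos z i.
Proof.
move=> z0 ij; have sp l : 0 < pos z l.+1 - pos z l.
  rewrite spacing_position; apply: (spacing_of_prop (P := fun r => 0 < r)) => //.
  exact: le_lt_trans (V_rhc_ge0 hV) (rhc_zmax hV).
have := @dist_ge_nat _ (pos z) 0 i.+1 j ij; rewrite mulr0.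
by have := sp i => + /(_ (fun l _ => ltW (sp l))); lra.
Qed.

Lemma energy_EFin n (z : 'rV[R]_n) : (forall k, rhc < z ord0 k) ->
  energy v m p (N := n.+1) z = (E n.+1 (pos z))%:E.
Proof.
move=> rz; have bz l : rhc <= pos z l.+1 - pos z l.
  rewrite spacing_position; apply: (spacing_of_prop (P := fun r => rhc <= r)).
    exact/ltW/(rhc_zmax hV).
  by move=> k; exact: ltW.
have z0 k : 0 < z ord0 k by apply: le_lt_trans (rz k); exact: (V_rhc_ge0 hV).
rewrite /energy /chain_energy EFinD -sumEFin; congr (_ + _)%E; last first.
  congr (_ * _)%:E; rewrite position_sub//=; apply: eq_bigl => k.
  by rewrite ltn_ord.
apply: eq_bigr => i _; rewrite -sumEFin; apply: eq_bigr => j /andP[ij _].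
have jn : (j <= n)%N by rewrite -ltnS.
rewrite -position_sub ?jn ?(ltnW ij)// (vrealK hV)//.
have sp : rhc < pos z i.+1 - pos z i.
  have iN : (i < n)%N by exact: leq_trans ij jn.
  by rewrite spacing_position (spacing_of_ord _ _ (Ordinal iN)).
have := @dist_ge_nat _ (pos z) 0 i.+1 j ij; rewrite mulr0.
have r0 := V_rhc_ge0 hV.
by move=> /(_ (fun l _ => le_trans r0 (bz l))); lra.
Qed.

(** The nearest-neighbour pair across the short spacing has energy [+oo], and no pair has energy
    [-oo] to cancel it. *)
Lemma energy_pinfty n (z : 'rV[R]_n) : (forall k, 0 < z ord0 k) ->
  (exists k, z ord0 k <= rhc) -> energy v m p (N := n.+1) z = +oo%E.
Proof.
move=> z0 [k zk]; rewrite /energy.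
suff -> : (\sum_(i < n.+1) \sum_(j < n.+1 | (i < j)%N && in_range m (j - i))
    v (\sum_(k0 < n | (i <= k0 < j)%N) z ord0 k0)%R = +oo)%E by [].
have noN (i j : 'I_n.+1) : (i < j)%N -> v (\sum_(k0 < n | (i <= k0 < j)%N) z ord0 k0)%R != -oo%E.
  move=> ij; apply: vreal_gtNy; rewrite -position_sub; first exact: position_lt.
  by rewrite ltnW//= -ltnS.
have k1 : (k.+1 < n.+1)%N by rewrite ltnS.
pose i : 'I_n.+1 := Ordinal (ltnW k1); pose j : 'I_n.+1 := Ordinal k1.
apply/esum_eqyP; last exists i.
  by move=> i' _; apply/negP => /eqP/esum_eqNyP[j' [_ /andP[ij' _]]] /eqP; exact/negP/noN.
split=> //.
apply/esum_eqyP => [j' /andP[ij' _]|]; first exact: noN.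
exists j; rewrite mem_index_enum /= ltnSn subSnn (in_range1 hm); split => //.
rewrite (big_pred1 k) ?(V_hard_core hV)// => l /=.
by rewrite ltnS -eqn_leq eq_sym.
Qed.

(** Chains with a spacing in the hard core have energy [+oo] and do not compete; among the others
    the strict part of [energy_box_le] forces a minimizer into the box. *)
Lemma minimizer_real n (z : 'rV[R]_n) :
  minimizer (pos_spacings R n.+1) (@energy R v m p n.+1) z <->
  (forall k, zmin <= z ord0 k <= zmax) /\
  forall y, (forall l, rhc < y l.+1 - y l) -> E n.+1 (pos z) <= E n.+1 y.
Proof.
have rz := V_rhc_zmin hV; have r0 := V_rhc_ge0 hV; have rzm := rhc_zmax hV.
have zz := V_zmin_zmax hV.
split=> [[z0 zmn]|[bz zmn]]; last first.
  have zr k : rhc < z ord0 k by have /andP[] := bz k; lra.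
  split=> [k|y y0]; first exact: le_lt_trans r0 (zr k).
  rewrite energy_EFin//.
  have [/forallP yr|] := boolP [forall k, rhc < y ord0 k].
    rewrite energy_EFin// lee_fin; apply: zmn => l.
    by rewrite spacing_position; apply: (spacing_of_prop (P := fun r => rhc < r)).
  rewrite negb_forall => /existsP[k]; rewrite -leNgt => yk.
  by rewrite energy_pinfty ?leey//; exists k.
have zr k : rhc < z ord0 k.
  rewrite ltNge; apply/negP => zk.
  (* The chain with all spacings equal to [zmax] has finite energy. *)
  have := zmn (const_mx zmax); rewrite energy_pinfty//; last by exists k.
  rewrite energy_EFin => [|k']; last by rewrite mxE.
  move=> /(_ _)/=; rewrite leye_eq => H.
  by have : false by apply: H => k'; rewrite mxE; lra.
have zmin' y : (forall l, rhc < y l.+1 - y l) -> E n.+1 (pos z) <= E n.+1 y.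
  move=> ry; pose u : 'rV[R]_n := \row_k spacing y k.
  have ru k : rhc < u ord0 k by rewrite mxE; exact: ry.
  have := zmn u; rewrite !energy_EFin// lee_fin => /(_ _) H.
  rewrite -(@chain_energy_eq _ w m p n.+1 (pos u) y); last first.
    by move=> l ln; have := @position_of_row _ zmax n y l ln; rewrite /spacing.
  by apply: H => k; exact: le_lt_trans r0 (ru k).
split=> // k; apply/negPn/negP => zk.
have rp l : rhc < pos z l.+1 - pos z l.
  by rewrite spacing_position; apply: (spacing_of_prop (P := fun r => rhc < r)).
have [u [bu _ ult]] := energy_box_le hw hm p0 pneg n.+1 rp.
have kn : (k.+1 < n.+1)%N by rewrite ltnS.
have := ult k kn; rewrite spacing_position spacing_of_ord => /(_ zk).
by rewrite ltNge zmin'//; exact: (box_gt_rhc hw).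
Qed.

Lemma ereal_minimizer_critical n (z : 'rV[R]_n) :
  minimizer (pos_spacings R n.+1) (@energy R v m p n.+1) z ->
  critical (derive1 w) zmin zmax m p n.+1 (pos z).
Proof.
move=> /minimizer_real[bz zmn]; apply: (minimizer_critical hw) => //.
exact: (box_position hw).
Qed.

Lemma bulk_energy_lim r : bulk_energy v m p r =
  ((p * r)%:E + limn (fun n => \sum_(1 <= k < n | in_range m k) v (k%:R * r)%R))%E.
Proof.
rewrite /bulk_energy; case: (m) => [m0|//]; congr (_ + _)%E.
apply/esym/lim_near_cst => //; exists m0.+1 => // n /= mn.
by rewrite [RHS](big_nat_widen _ _ _ _ _ mn); apply: eq_bigl => k; rewrite ltnS.
Qed.

Lemma bulk_energy_EFin r : rhc < r -> bulk_energy v m p r = (bulk w m p r)%:E.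
Proof.
move=> rr; rewrite bulk_energy_lim /bulk EFinD; congr (_ + _)%E.
rewrite -EFin_lim; last exact: (partial_bulk_is_cvg hw hm rr).
congr (limn _); apply/funext => n /=; rewrite -sumEFin big_nat_cond [RHS]big_nat_cond.
apply: eq_bigr => k /andP[/andP[k1 _] _]; rewrite (vrealK hV)//.
apply: (lt_le_trans rr); rewrite ler_peMl ?ler1n//.
exact: ltW (le_lt_trans (V_rhc_ge0 hV) rr).
Qed.

Lemma bulk_energy_pinfty r : 0 < r -> r <= rhc -> bulk_energy v m p r = +oo%E.
Proof.
move=> r0 rr; rewrite bulk_energy_lim.
rewrite (_ : limn _ = +oo%E)//; apply: lim_near_cst => //; exists 2%N => // n /= n2.
rewrite big_nat_cond; apply/esum_eqyP => [k /andP[/andP[k1 _] _]|].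
  by apply: vreal_gtNy; rewrite mulr_gt0// ltr0n.
exists 1%N; rewrite mem_index_iota n2 (in_range1 hm); split => //.
by rewrite mul1r (V_hard_core hV).
Qed.
Lemma chain_minimizer (n : nat) : exists z : 'rV[R]_n,
  unique_minimizer (pos_spacings R n.+1) (@energy R v m p n.+1) z /\
  forall k : 'I_n, zmin <= z ord0 k <= zmax.
Proof.
have [z bz zmn] := energy_minimizer_exists hw hm p0 pneg n.
have mz : minimizer (pos_spacings R n.+1) (@energy R v m p n.+1) z by apply/minimizer_real.
exists z; split => //; split => // z' mz'; apply/rowP => k.
have := critical_unique hw hm (ereal_minimizer_critical mz) (ereal_minimizer_critical mz') (q := k).
rewrite /spacing !spacing_position !spacing_of_ord; apply.
by rewrite ltnS.
Qed.

(** The limits are computed along one chosen minimizer per length; the conclusion of [bulk_limit]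
    holds for every critical chain, hence for the minimizers [z N] of the statement. *)
Lemma thermodynamic_limit : exists a : R,
  [/\ zmin < a <= zmax,
      unique_minimizer (pos_reals R) (bulk_energy v m p) a,
      (forall z : forall N : nat, 'rV[R]_N.-1,
         (forall N : nat, (2 <= N)%N ->
            minimizer (pos_spacings R N) (@energy R v m p N) (z N)) ->
         forall eps : R, 0 < eps ->
           exists K : nat, forall (N : nat) (k : 'I_N.-1),
             (K <= k.+1)%N -> (K <= N - k.+1)%N ->
             `|z N ord0 k - a| < eps)
    & exists e0 : R,
        [/\ (ground_energy v m p N * (N%:R^-1)%:E)%E @[N --> \oo] --> e0%:E,
            e0 < 0,
            e0%:E = bulk_energy v m p a
          & e0%:E = ereal_inf [set bulk_energy v m p r | r in pos_reals R]]].
Proof.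
have [Z HZ] : {Z : forall n, 'rV[R]_n & forall n,
    minimizer (pos_spacings R n.+1) (@energy R v m p n.+1) (Z n)}.
  have ex n : {z : 'rV[R]_n | minimizer (pos_spacings R n.+1) (@energy R v m p n.+1) z}.
    by apply: cid; have [z [[mz _] _]] := chain_minimizer n; exists z.
  by exists (fun n => sval (ex n)) => n; exact: svalP (ex n).
(* [Z n] has [n] spacings, so the chain of [N] particles comes from [Z N.-1]. *)
pose X N := pos (Z N.-1).
have bX N : box zmin zmax (X N).
  by apply: (box_position hw); have /minimizer_real[] := HZ N.-1.
have cX N : (2 <= N)%N -> critical (derive1 w) zmin zmax m p N (X N).
  by case: N => [|[|N]]// _; exact: ereal_minimizer_critical.
have mX N y : (forall l, rhc < y l.+1 - y l) -> E N.+1 (X N.+1) <= E N.+1 y.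
  by move=> ry; have /minimizer_real[_] := HZ N; exact.
have [a ab Ha] := bulk_limit hw hm cX.
have dX : E N (X N) / N%:R @[N --> \oo] --> bulk w m p a.
  apply: (energy_density hw p0) => // e e0; have [K HK] := Ha e e0.
  exists K => N q Kq qN; apply: (HK N) => //; apply: cX; move: qN; clear; lia.
have [za amin] := bulk_minimizer hw hm p0 pneg bX mX ab dX.
have ra : rhc < a := lt_trans (V_rhc_zmin hV) za.
have a0 : 0 < a := le_lt_trans (V_rhc_ge0 hV) ra.
have bulk_gt r : 0 < r -> r != a -> (bulk_energy v m p a < bulk_energy v m p r)%E.
  move=> r0 rNa; rewrite (bulk_energy_EFin ra).
  have [rr|rr] := leP r rhc; first by rewrite bulk_energy_pinfty// ltry.
  by rewrite bulk_energy_EFin// lte_fin; exact: amin.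
have bulk_min : minimizer (pos_reals R) (bulk_energy v m p) a.
  split=> // r r0; have [->//|rNa] := eqVneq r a; exact/ltW/bulk_gt.
have groundE N : ground_energy v m p N.+1 = (E N.+1 (X N.+1))%:E.
  have [z0 zmn] := HZ N; have /minimizer_real[bz _] := HZ N.
  rewrite -energy_EFin; last first.
    by move=> k; have /andP[+ _] := bz k; apply: lt_le_trans (V_rhc_zmin hV).
  apply/eqP; rewrite eq_le; apply/andP; split.
    by apply: ereal_inf_lbound; exists (Z N).
  by apply: le_ereal_inf_tmp => _ [y y0 <-]; exact: zmn.
exists a; split.
- by rewrite za; have /andP[] := ab.
- split=> // r [r0 rmin]; apply/eqP/negPn/negP => aNr.
  by have := bulk_gt r r0; rewrite eq_sym aNr => /(_ isT); rewrite ltNge rmin.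
- move=> z mz eps eps0; have e20 : 0 < eps / 2 by rewrite divr_gt0.
  have [K HK] := Ha _ e20; exists K.+3 => N k Kk KN.
  apply: (@le_lt_trans _ _ (eps / 2)); last by rewrite ltr_pdivrMr// ltr_pMr// ltr1n.
  case: N k Kk KN => [|[|N]]; [by case|by case|] => k Kk KN.
  have := HK N.+2 (pos (z N.+2)) k.
  rewrite /spacing spacing_position spacing_of_ord; apply.
  + by apply: ereal_minimizer_critical; exact: mz.
  + by move: Kk; clear; lia.
  + by move: KN; clear; lia.
- exists (bulk w m p a); split.
  + apply/fine_cvgP; split.
      exists 1%N => // -[|N]//= _; by rewrite groundE.
    apply: cvg_trans dX; apply: near_eq_cvg; exists 1%N => // -[|N]//= _.
    by rewrite groundE.
  + apply: le_lt_trans (bulk_zmax_lt0 hw hm p0 pneg).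
    have [->//|zNa] := eqVneq zmax a; exact/ltW/amin/zNa/(rhc_zmax hV).
  + by rewrite bulk_energy_EFin.
  + rewrite -bulk_energy_EFin//; apply/eqP; rewrite eq_le; apply/andP; split.
      by apply: le_ereal_inf_tmp => _ [y y0 <-]; apply bulk_min.
    by apply: ereal_inf_lbound; exists a.
Qed.

End from_ereal.

Theorem theorem2p1 (R : realType) (v : R -> \bar R)
    (rhc zmin zmax alpha1 alpha2 s : R)
    (hV : assumptionV v rhc zmin zmax alpha1 alpha2 s)
    (m : option nat) (hm : m <> Some 0%N)
    (p : R) (hp0 : 0 <= p) (hp : p < `|fine (v zmax)| / zmax) :
  (forall N : nat, (2 <= N)%N ->
     exists z : 'rV[R]_N.-1,
       unique_minimizer (pos_spacings R N) (@energy R v m p N) z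
       /\ forall k : 'I_N.-1, zmin <= z ord0 k <= zmax)
  /\
  exists a : R,
    [/\ zmin < a <= zmax,
        unique_minimizer (pos_reals R) (bulk_energy v m p) a,
        (forall z : forall N : nat, 'rV[R]_N.-1,
           (forall N : nat, (2 <= N)%N ->
              minimizer (pos_spacings R N) (@energy R v m p N) (z N)) ->
           forall eps : R, 0 < eps ->
             exists K : nat, forall (N : nat) (k : 'I_N.-1),
               (K <= k.+1)%N -> (K <= N - k.+1)%N ->
               `|z N ord0 k - a| < eps)
      & exists e0 : R,
          [/\ (ground_energy v m p N * (N%:R^-1)%:E)%E @[N --> \oo] --> e0%:E,
              e0 < 0,
              e0%:E = bulk_energy v m p a
            & e0%:E = ereal_inf [set bulk_energy v m p r | r in pos_reals R]]].
Proof.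
have [Q hw] := chain_potential_vreal hV.
have zmax0 : 0 < zmax by exact: le_lt_trans (V_rhc_ge0 hV) (rhc_zmax hV).
(* Since [v zmax] is negative, this is the bound on [p] multiplied by [zmax]. *)
have pneg : p * zmax + vreal v zmax < 0.
  have := cp_neg hw; move: hp; rewrite ltr_pdivlMr// -/(vreal v zmax) => + wneg.
  by rewrite ltr0_norm// -subr_gt0 -[_ < 0]oppr_gt0 opprD addrC.
split; last exact: (thermodynamic_limit hV hw hm hp0 pneg).
by case=> [|[|n]]// _; exact: (chain_minimizer hV hw hm hp0 pneg).
Qed.
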